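(* Let $K$ be a field, let $n\ge3$, let $M$ be the Chinese monoid of rank $n$, and let $D$ be the tree of diagrams for $n$, with associated congruences $\rho(d)$ on $M$ for $d\in D$. Every prime ideal of $K[M]$ contains a prime ideal of the form $\mathcal{I}_{\rho(d)}$, where $\rho(d)$ is the congruence corresponding to a leaf $d$ of $D$.
   Context: The Chinese monoid of rank $n$ is the monoid $M=\langle a_1,\dots,a_n\rangle$ defined by the relations $a_ja_ia_k=a_ja_ka_i=a_ka_ja_i$ for $i\le k\le j$; $K[M]$ is its monoid algebra. For a congruence $\eta$ on $M$, $\mathcal{I}_\eta$ is the ideal of $K[M]$ spanned over $K$ by $\{s-t: (s,t)\in\eta\}$. **The tree $D$.** A diagram is a collection of dots (a dot $a_s$ uses the single index $s$) and arcs (an arc $a_ya_x$, $x<y$, uses the two indices $x,y$) on $\{1,\dots,n\}$, each index being used at most once. The vertices of the finite tree $D$ are the following diagrams, built level by level. The root (level 0) is the empty diagram. The children of the root (level 1) are the $n-2$ single dots $a_s$, $s=2,\dots,n-1$, and the $n-1$ single arcs $a_sa_{s-1}$, $s=2,\dots,n$. In each non-root vertex the used indices form an interval $\{u,u+1,\dots,v\}$. A non-root vertex is a leaf (it has no children) if it contains an arc using index $1$ or index $n$. If a non-root vertex $d$ with used interval $\{u,\dots,v\}$ is not a leaf (then $1<u\le v<n$), its children are: (i) the diagram obtained by adding the arc $a_{v+1}a_{u-1}$; (ii) if the last step in the construction of $d$ was adding an arc: the diagram obtained by adding the dot $a_{v+1}$ (provided $v+1<n$) and the diagram obtained by adding the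 dot $a_{u-1}$ (provided $u-1>1$); (iii) if $d$ is in level $\ge 2$ and the last step was adding a dot: if that dot was $a_v$, the diagram obtained by adding the dot $a_{v+1}$ (provided $v+1<n$); if that dot was $a_u$, the diagram obtained by adding the dot $a_{u-1}$ (provided $u-1>1$). (If $d$ is a single dot in level 1, its only child is the one in (i).) **The congruences $\rho(d)$.** Let $B=\langle p,q: qp=1\rangle$ be the bicyclic monoid, let $\mathbb{N}$ (nonnegative integers under addition) be written multiplicatively as $\langle g\rangle$, and $\mathbb{Z}$ as $\langle g,g^{-1}\rangle$. For an interval $\{u,\dots,v\}$ let $C_{u,v}$ be the monoid generated by the $a_i$ with $i<u$ or $i>v$, subject to the Chinese relations among these generators and the additional relations that $a_1,\dots,a_{u-1}$ commute with each other and $a_{v+1},\dots,a_n$ commute with each other (it is trivial if there are no generators). Let $d\in D$ be in level $r$, with branch $d_0$ (root), $d_1,\dots,d_r=d$ leading from the root to $d$. Put $C_0=M$, $S_0=\{1\}$, and for $t\ge1$ let $C_t=C_{u,v}$, where $\{u,\dots,v\}$ is the set of used indices of $d_t$. For $0\le t<r$: - if $d_{t+1}$ arises from $d_t$ by adding a dot $a_s$, put $S_{t+1}=\mathbb{N}\times S_t$ and let $\psi_t: C_t\to C_{t+1}\times \mathbb{N}$ be the homomorphism with $a_s\mapsto(1,g)$ and $a_l\mapsto(a_l,1)$ for $l\ne s$; - if $d_{t+1}$ arises from $d_t$ by adding an arc $a_ya_x$ ($x<y$), put $S_{t+1}=B\times\mathbb{Z}\times S_t$ and let $\psi_t:C_t\to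 C_{t+1}\times B\times\mathbb{Z}$ be the homomorphism with $a_x\mapsto(1,p,g)$, $a_y\mapsto(1,q,1)$, $a_l\mapsto(a_l,p,1)$ for $l<x$, $a_l\mapsto(a_l,q,1)$ for $l>y$. Let $\kappa_t=\psi_t\times \mathrm{id}: C_t\times S_t\to C_{t+1}\times S_{t+1}$. Then $\rho(\text{root})$ is the trivial congruence on $M$ and, for $r\ge1$, $\rho(d)$ is the kernel congruence of $\kappa_{r-1}\circ\dots\circ\kappa_0: M\to C_r\times S_r$. *)

(* Defs.v *)
From HB Require Import structures.
From mathcomp Require Import all_boot all_algebra.
From mathcomp Require Import boolp classical_sets.
From mathcomp.multinomials Require Import monalg.
From mathcomp Require Import zify.

Set Implicit Arguments.
Unset Strict Implicit.
Unset Printing Implicit Defensive.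

Import GRing.Theory.

Local Open Scope quotient_scope.

Section Presentation.
Local Open Scope group_scope.
Variables (X : choiceType) (R : seq X -> seq X -> Prop).

Inductive pres_cong : seq X -> seq X -> Prop :=
| pres_rel u v r s : R r s -> pres_cong (u ++ r ++ v) (u ++ s ++ v)
| pres_refl w : pres_cong w w
| pres_sym w w' : pres_cong w w' -> pres_cong w' w
| pres_trans w1 w2 w3 : pres_cong w1 w2 -> pres_cong w2 w3 -> pres_cong w1 w3.

Lemma pres_rel0 r s : R r s -> pres_cong r s.
Proof. by move=> /(pres_rel [::] [::]); rewrite !cats0. Qed.

(* A boolean version, by classical logic, in order to form the quotient type. *)
Definition pres_congb : rel (seq X) := fun w w' => `[< pres_cong w w' >].

Fact pres_congb_refl : reflexive pres_congb.
Proof. by move=> w; apply/asboolP; apply: pres_refl. Qed.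

Fact pres_congb_sym : symmetric pres_congb.
Proof. by move=> w w'; apply/asboolP/asboolP; apply: pres_sym. Qed.

Fact pres_congb_trans : transitive pres_congb.
Proof.
move=> w2 w1 w3 /asboolP h /asboolP h'; apply/asboolP.
exact: pres_trans h h'.
Qed.

Canonical pres_equiv :=
  EquivRel pres_congb pres_congb_refl pres_congb_sym pres_congb_trans.

(* The monoid < X | r = s for R r s >. *)
Definition pres := {eq_quot pres_equiv}.

HB.instance Definition _ := Choice.on pres.
HB.instance Definition _ := Quotient.on pres.

Lemma pres_eqP w w' : \pi_pres w = \pi_pres w' <-> pres_cong w w'.
Proof.
have <- : w = w' %[mod {eq_quot pres_equiv}] <->
          \pi_pres w = \pi_pres w' by [].
split=> [/eqmodP/asboolP //|h]; exact/eqmodP/asboolP.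
Qed.

Lemma pres_cong_cat w1 w1' w2 w2' :
  pres_cong w1 w1' -> pres_cong w2 w2' -> pres_cong (w1 ++ w2) (w1' ++ w2').
Proof.
move=> h1 h2; apply: (@pres_trans _ (w1' ++ w2)).
  elim: h1 => [u v r s rs|w|w w' _|a b c _ hab _ hbc].
  - by rewrite -!catA; apply: pres_rel.
  - exact: pres_refl.
  - exact: pres_sym.
  - exact: pres_trans hab hbc.
elim: h2 => [u v r s rs|w|w w' _|a b c _ hab _ hbc].
- by rewrite !(catA w1'); apply: pres_rel.
- exact: pres_refl.
- exact: pres_sym.
- exact: pres_trans hab hbc.
Qed.

Definition pres_one : pres := \pi_pres [::].
Definition pres_mul (x y : pres) : pres := \pi_pres (repr x ++ repr y).

Lemma pres_mulE w w' : pres_mul (\pi_pres w) (\pi_pres w') = \pi_pres (w ++ w').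
Proof. by apply/pres_eqP/pres_cong_cat; apply/pres_eqP; rewrite reprK. Qed.

Fact pres_mulA : associative pres_mul.
Proof.
move=> x y z; rewrite -[x]reprK -[y]reprK -[z]reprK.
by rewrite !pres_mulE !reprK catA.
Qed.

Fact pres_mul1 : left_id pres_one pres_mul.
Proof. by move=> x; rewrite -[x]reprK pres_mulE. Qed.

Fact pres_mulr1 : right_id pres_one pres_mul.
Proof. by move=> x; rewrite -[x]reprK pres_mulE cats0. Qed.

HB.instance Definition _ := isMonoid.Build pres pres_mulA pres_mul1 pres_mulr1.

Definition pres_gen (x : X) : pres := \pi_pres [:: x].

(* The map x |-> f x on generators, extended to pres by multiplying out a chosen
   representative word.  By pres_lift_morph it is the homomorphism determined
   by f as soon as f satisfies the defining relations. *)
Definition pres_lift (N : monoidType) (f : X -> N) (x : pres) : N :=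
  \prod_(i <- repr x) f i.

Definition satisfies (N : monoidType) (f : X -> N) : Prop :=
  forall r s, R r s -> \prod_(i <- r) f i = \prod_(i <- s) f i.

Lemma pres_cong_prod (N : monoidType) (f : X -> N) w w' : satisfies f ->
  pres_cong w w' -> \prod_(i <- w) f i = \prod_(i <- w') f i.
Proof.
move=> fR; elim=> [u v r s /fR rs|//|//|a b c _ -> _ -> //].
by rewrite !big_cat /= rs.
Qed.

Lemma pres_lift_pi (N : monoidType) (f : X -> N) w :
  satisfies f -> pres_lift f (\pi_pres w) = \prod_(i <- w) f i.
Proof.
move=> fR; apply: pres_cong_prod => //.
by apply/pres_eqP; rewrite reprK.
Qed.

Lemma pres_lift_morph (N : monoidType) (f : X -> N) : satisfies f ->
  monoid.monoid_morphism (pres_lift f) /\ forall x, pres_lift f (pres_gen x) = f x.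
Proof.
move=> fR; split; last by move=> x; rewrite pres_lift_pi // big_seq1.
split=> [|x y]; first by rewrite (pres_lift_pi [::] fR) big_nil.
rewrite -[x]reprK -[y]reprK [_ * _]pres_mulE.
by rewrite !pres_lift_pi // big_cat.
Qed.

End Presentation.

Fact unit_mulA : associative (fun _ _ : unit => tt). Proof. by []. Qed.
Fact unit_mul1 : left_id tt (fun _ _ : unit => tt). Proof. by case. Qed.
Fact unit_mulr1 : right_id tt (fun _ _ : unit => tt). Proof. by case. Qed.
HB.instance Definition _ := isMonoid.Build unit unit_mulA unit_mul1 unit_mulr1.

Inductive chinese_rel (A : pred nat) : seq {i | A i} -> seq {i | A i} -> Prop :=
| chinese_jik i k j : val i <= val k <= val j ->
    chinese_rel [:: j; i; k] [:: j; k; i]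
| chinese_jki i k j : val i <= val k <= val j ->
    chinese_rel [:: j; k; i] [:: k; j; i].

Definition chinese_monoid (n : nat) := pres (@chinese_rel (fun i => 0 < i <= n)).

HB.instance Definition _ n := Choice.on (chinese_monoid n).
HB.instance Definition _ n := Monoid.on (chinese_monoid n).

Fact chinese_monoid_unitm n (x y : chinese_monoid n) :
  (x * y = 1 -> x = 1 /\ y = 1)%g.
Proof.
have sz w w' : pres_cong (@chinese_rel (fun i => 0 < i <= n)) w w' ->
    size w = size w'.
  elim=> [u v r s [] *|||a b c _ -> _ ->] //; by rewrite !size_cat.
rewrite -[x]reprK -[y]reprK [(_ * _)%g]pres_mulE.
move=> /pres_eqP/sz; rewrite size_cat.
by case: (repr x) => //; case: (repr y).
Qed.

HB.instance Definition _ n := Choice_isMonomialDef.Build (chinese_monoid n)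
  (@mulgA (chinese_monoid n)) (@mul1g (chinese_monoid n))
  (@mulg1 (chinese_monoid n)) (@chinese_monoid_unitm n).

(* The bicyclic monoid < p, q | qp = 1 >, with p, q the letters true, false. *)
Inductive bicyclic_rel : seq bool -> seq bool -> Prop :=
| bicyclic_qp : bicyclic_rel [:: false; true] [::].

Definition bicyclic := pres bicyclic_rel.
HB.instance Definition _ := Choice.on bicyclic.
HB.instance Definition _ := Monoid.on bicyclic.

Definition bicyclic_p : bicyclic := pres_gen bicyclic_rel true.
Definition bicyclic_q : bicyclic := pres_gen bicyclic_rel false.

(* PDot s is the dot a_s; PArc y x is the arc a_y a_x, with x < y. *)
Inductive piece := PDot of nat | PArc of nat & nat.

Definition piece_indices (c : piece) : seq nat :=
  match c with PDot s => [:: s] | PArc y x => [:: y; x] end.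

(* A diagram is recorded with its construction, the most recently added piece
   first: the branch leading to d consists of the suffixes of d, the level of d
   is its length, and the root is [::]. *)
Definition diagram := seq piece.

Definition used (d : diagram) : seq nat := flatten (map piece_indices d).

(* The interval {u, ..., v} of used indices, for d <> [::]. *)
Definition lo (d : diagram) : nat := foldr minn (head 0 (used d)) (used d).
Definition hi (d : diagram) : nat := foldr maxn 0 (used d).

Definition has_end_arc (n : nat) (d : diagram) : bool :=
  has (fun c => if c is PArc y x then (1 \in [:: y; x]) || (n \in [:: y; x])
                else false) d.

(* The child_dot cases treat a vertex d whose last added piece is a dot; it is
   the dot a_v, resp. a_u, where {u, ..., v} is the used interval of d. *)
Inductive child (n : nat) : diagram -> diagram -> Prop :=
| child_root_dot s : 2 <= s <= n - 1 -> child n [::] [:: PDot s]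
| child_root_arc s : 2 <= s <= n -> child n [::] [:: PArc s (s - 1)]
| child_arc d : d <> [::] -> ~~ has_end_arc n d ->
    child n d (PArc (hi d + 1) (lo d - 1) :: d)
| child_arc_hi d y x d' : d = PArc y x :: d' -> ~~ has_end_arc n d ->
    hi d + 1 < n -> child n d (PDot (hi d + 1) :: d)
| child_arc_lo d y x d' : d = PArc y x :: d' -> ~~ has_end_arc n d ->
    1 < lo d - 1 -> child n d (PDot (lo d - 1) :: d)
| child_dot_hi d d' : d = PDot (hi d) :: d' -> 2 <= size d ->
    ~~ has_end_arc n d -> hi d + 1 < n -> child n d (PDot (hi d + 1) :: d)
| child_dot_lo d d' : d = PDot (lo d) :: d' -> 2 <= size d ->
    ~~ has_end_arc n d -> 1 < lo d - 1 -> child n d (PDot (lo d - 1) :: d).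

Inductive in_tree (n : nat) : diagram -> Prop :=
| in_tree_root : in_tree n [::]
| in_tree_child d e : in_tree n d -> child n d e -> in_tree n e.

Definition is_leaf (n : nat) (d : diagram) : Prop :=
  [/\ in_tree n d, d <> [::] & has_end_arc n d].

(* Generators and relations of C_t: those of the Chinese monoid for the root,
   and those of C_{u,v} for a non-root vertex with used interval {u, ..., v}. *)
Definition level_gens (n : nat) (d : diagram) : pred nat :=
  match d with
  | [::] => fun i => 0 < i <= n
  | _ => fun i => (0 < i <= n) && ((i < lo d) || (hi d < i))
  end.

Inductive interval_rel (A : pred nat) (u v : nat) :
    seq {i | A i} -> seq {i | A i} -> Prop :=
| interval_chinese r s : chinese_rel r s -> interval_rel u v r s
| interval_comm_lo i j : val i < u -> val j < u ->
    interval_rel u v [:: i; j] [:: j; i]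
| interval_comm_hi i j : v < val i -> v < val j ->
    interval_rel u v [:: i; j] [:: j; i].

Definition level_rel (n : nat) (d : diagram) :
    seq {i | level_gens n d i} -> seq {i | level_gens n d i} -> Prop :=
  match d with
  | [::] => @chinese_rel _
  | c :: d' => @interval_rel _ (lo (c :: d')) (hi (c :: d'))
  end.

(* C_t; level_monoid n [::] is convertible to chinese_monoid n. *)
Definition level_monoid (n : nat) (d : diagram) : monoidType :=
  pres (@level_rel n d).

(* The generator a_i of C_t, for an index i not used in d. *)
Definition level_gen (n : nat) (d : diagram) (i : nat) : level_monoid n d :=
  if insub i is Some x then pres_gen (@level_rel n d) x else 1%g.

(* N and Z written multiplicatively; the generator g is 1%N, resp. 1%Z. *)
Definition factor (c : piece) : monoidType :=
  match c with
  | PDot _ => Algebra.to_multiplicative nat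
  | PArc _ _ => (bicyclic * Algebra.to_multiplicative int)%type
  end.

Fixpoint side_monoid (d : diagram) : monoidType :=
  match d with
  | [::] => unit
  | c :: d' => (factor c * side_monoid d')%type
  end.

(* In the last clause y < l: the indices strictly between x and y are used. *)
Definition psi_gen (n : nat) (c : piece) (d : diagram)
    (l : {i | level_gens n d i}) : level_monoid n (c :: d) * factor c :=
  match c return level_monoid n (c :: d) * factor c with
  | PDot s =>
      if val l == s then (1%g, 1%N : Algebra.to_multiplicative nat)
      else (level_gen n (PDot s :: d) (val l), 1%g)
  | PArc y x =>
      if val l == x then (1%g, (bicyclic_p, 1%Z : Algebra.to_multiplicative int))
      else if val l == y then (1%g, (bicyclic_q, 1%g))
      else if val l < x then
        (level_gen n (PArc y x :: d) (val l), (bicyclic_p, 1%g))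
      else (level_gen n (PArc y x :: d) (val l), (bicyclic_q, 1%g))
  end.

Definition psi (n : nat) (c : piece) (d : diagram) :
    level_monoid n d -> level_monoid n (c :: d) * factor c :=
  pres_lift (@psi_gen n c d).

Lemma lo_le_hi d : lo d <= hi d.
Proof.
rewrite /lo /hi; case: (used d) => //= a l.
have h1 : foldr maxn 0 (a :: l) >= a by rewrite /= leq_maxl.
have h2 b : foldr minn a b <= a by elim: b => //= x b; lia.
by have := h2 (a :: l); rewrite /= in h1 *; lia.
Qed.

Lemma hi_cons c d : hi d <= hi (c :: d).
Proof. by case: c => *; rewrite /hi /used /=; lia. Qed.

Lemma lo_cons_le c e d : lo [:: c, e & d] <= lo (e :: d).
Proof.
have lb a l i : i \in l -> foldr minn a l <= i.
  by elim: l => //= x l IH; rewrite inE => /predU1P[->|/IH]; lia.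
have mem a l : a \in l -> foldr minn a l \in l.
  have : foldr minn a l \in a :: l.
    elim: l => [|x l IH] /=; first by rewrite mem_head.
    case: (leqP x (foldr minn a l)) => h; first by rewrite !inE eqxx orbT.
    by move: IH; rewrite !inE => /orP[->|->]; rewrite ?orbT.
  by rewrite inE => /predU1P[->|].
have hd : head 0 (used (e :: d)) \in used (e :: d).
  by case: e => *; rewrite mem_head.
by apply: lb; rewrite {1}/used /= mem_cat mem ?orbT.
Qed.

Lemma level_gen_out n d i : ~~ level_gens n d i -> level_gen n d i = 1%g.
Proof. by rewrite /level_gen => h; rewrite insubN. Qed.

Lemma level_genE n d i (h : level_gens n d i) :
  level_gen n d i = pres_gen (@level_rel n d) (exist _ i h).
Proof. by rewrite /level_gen (insubT _ h). Qed.

Lemma pres_genM (X : choiceType) (R : seq X -> seq X -> Prop) w :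
  (\prod_(i <- w) pres_gen R i)%g = \pi_(pres R) w.
Proof.
elim: w => [|a w IH]; first by rewrite big_nil.
by rewrite big_cons IH [LHS]pres_mulE.
Qed.

Lemma level_gen_comm n c d i j :
  (i < lo (c :: d)) && (j < lo (c :: d)) ||
  (hi (c :: d) < i) && (hi (c :: d) < j) ->
  (level_gen n (c :: d) i * level_gen n (c :: d) j =
   level_gen n (c :: d) j * level_gen n (c :: d) i)%g.
Proof.
have [hi_|/level_gen_out->] := boolP (level_gens n (c :: d) i); last first.
  by rewrite mul1g mulg1.
have [hj|/level_gen_out->] := boolP (level_gens n (c :: d) j); last first.
  by rewrite mul1g mulg1.
move=> h; rewrite !level_genE.
have := @pres_genM _ (@level_rel n (c :: d)) [:: exist _ i hi_; exist _ j hj].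
have := @pres_genM _ (@level_rel n (c :: d)) [:: exist _ j hj; exist _ i hi_].
rewrite !big_cons !big_nil !mulg1 => -> ->; apply/pres_eqP.
apply: pres_rel0; case/orP: h => /andP[h1 h2].
  exact: interval_comm_lo.
exact: interval_comm_hi.
Qed.

Lemma level_gen_chinese n c d i k j :
  0 < i <= k -> k <= j <= n ->
  let F := level_gen n (c :: d) in
  (F j * (F i * F k) = F j * (F k * F i) /\
   F j * (F k * F i) = F k * (F j * F i))%g.
Proof.
move=> ik kj F.
have cl a b : 0 < a -> b <= n -> lo (c :: d) <= a <= hi (c :: d) ->
    (a <= b -> F b = 1%g \/ hi (c :: d) < b) .
  move=> a0 bn ab leab; rewrite /F.
  have [h|/level_gen_out->] := boolP (level_gens n (c :: d) b); last by left.
  by right; move: h => /=; lia.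
have cl' a b : 0 < a -> b <= n -> lo (c :: d) <= a <= hi (c :: d) ->
    (b <= a -> F b = 1%g \/ b < lo (c :: d)).
  move=> a0 bn ab leab; rewrite /F.
  have [h|/level_gen_out->] := boolP (level_gens n (c :: d) b); last by left.
  by right; move: h => /=; lia.
have [hi_|/[dup]/level_gen_out Fi ni] := boolP (level_gens n (c :: d) i);
  last first.
  rewrite -/F in Fi; rewrite Fi !mul1g !mulg1; split=> //.
  have hb : lo (c :: d) <= i <= hi (c :: d) by move: ni => /=; lia.
  case: (cl i k _ _ hb _); try lia; first by move=> ->; rewrite mul1g mulg1.
  case: (cl i j _ _ hb _); try lia; first by move=> ->; rewrite mul1g mulg1.
  by move=> hj hk; apply: level_gen_comm; lia.
have [hk|/[dup]/level_gen_out Fk nk] := boolP (level_gens n (c :: d) k);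
  last first.
  by rewrite -/F in Fk; rewrite Fk !mul1g !mulg1.
have [hj|/[dup]/level_gen_out Fj nj] := boolP (level_gens n (c :: d) j);
  last first.
  rewrite -/F in Fj; rewrite Fj !mul1g.
  have hb : lo (c :: d) <= j <= hi (c :: d) by move: nj => /=; lia.
  have : (F i * F k = F k * F i)%g; last by move=> ->.
  case: (cl' j k _ _ hb _); try lia; first by move=> ->; rewrite mul1g mulg1.
  case: (cl' j i _ _ hb _); try lia; first by move=> ->; rewrite mul1g mulg1.
  by move=> h1 h2; apply: level_gen_comm; lia.
pose R := @level_rel n (c :: d).
pose xi : {i | level_gens n (c :: d) i} := exist _ i hi_.
pose xk : {i | level_gens n (c :: d) i} := exist _ k hk.
pose xj : {i | level_gens n (c :: d) i} := exist _ j hj.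
have w3 a b e : (pres_gen R a * (pres_gen R b * pres_gen R e))%g =
    \pi_(pres R) [:: a; b; e].
  by rewrite -pres_genM !big_cons big_nil mulg1.
rewrite /F !level_genE -/R -/xi -/xk -/xj !w3; split; apply/pres_eqP;
  apply: pres_rel0; apply: interval_chinese.
  by apply: chinese_jik => /=; lia.
by apply: chinese_jki => /=; lia.
Qed.

Lemma lo_hi_cons c d i : i \in piece_indices c -> lo (c :: d) <= i <= hi (c :: d).
Proof.
move=> ic; have iu : i \in used (c :: d) by rewrite /used /= mem_cat ic.
rewrite /lo /hi; elim: (used _) (head _ _) iu => // a l IH b.
by rewrite inE => /predU1P[->|/(IH b)] /=; lia.
Qed.

Lemma child_arc_lt n y x d : child n d (PArc y x :: d) ->
  x < y /\ (d <> [::] -> lo d <= x.+1 /\ x <= hi d).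
Proof.
move=> h; inversion h as [|s hs e e1|d0 h0 h1 e e1| | | |]; subst.
  by split; [lia|].
by have := lo_le_hi d; split; lia.
Qed.

Lemma psi_gen1 n c d l : (@psi_gen n c d l).1 = level_gen n (c :: d) (val l).
Proof.
have out i : i \in piece_indices c -> level_gen n (c :: d) i = 1%g.
  by move=> /(lo_hi_cons d) h; apply: level_gen_out => /=; lia.
case: c out => [s|y x] out /=.
  by case: eqP => //= ->; rewrite out // mem_seq1.
case: eqP => [->|_] /=; first by rewrite out // !inE eqxx orbT.
case: eqP => [->|_] /=; first by rewrite out // !inE eqxx.
by case: ifP.
Qed.

(* psi_t is indeed the homomorphism with the prescribed values on generators. *)
Lemma psi_morph n c d : child n d (c :: d) ->
  monoid.monoid_morphism (@psi n c d) /\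
  forall l, @psi n c d (pres_gen (@level_rel n d) l) = @psi_gen n c d l.
Proof.
move=> cd; apply: pres_lift_morph.
have pairP (G H : monoidType) (a b : G * H) : a.1 = b.1 -> a.2 = b.2 -> a = b.
  by case: a b => [a1 a2] [b1 b2] /= -> ->.
have zC (V : nmodType) (a b : Algebra.to_multiplicative V) : (a * b = b * a)%g.
  exact: (@addrC V).
have qp : (bicyclic_q * bicyclic_p = 1)%g.
  rewrite [LHS]pres_mulE; apply/pres_eqP; exact: pres_rel0 bicyclic_qp.
have arc2 y x l : x < y -> (@psi_gen n (PArc y x) d l).2 =
    (if val l <= x then bicyclic_p else bicyclic_q,
     if val l == x then 1%Z : Algebra.to_multiplicative int else 1%g).
  move=> xy /=; case: (eqVneq (val l) x) => [->|hx] /=; first by rewrite leqnn.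
  case: (eqVneq (val l) y) => [->|hy] /=; first by rewrite leqNgt xy.
  by rewrite [val l <= x]leq_eqVlt (negPf hx) /=; case: ifP.
have comm2 i j : d <> [::] -> (val i < lo d) && (val j < lo d) ||
    (hi d < val i) && (hi d < val j) ->
    ((@psi_gen n c d i).2 * (@psi_gen n c d j).2 =
     (@psi_gen n c d j).2 * (@psi_gen n c d i).2)%g.
  case: c cd arc2 => [s _ _ _ _|y x cd arc2 d0 h]; first exact: zC.
  case: (child_arc_lt cd) => xy /(_ d0) [h1 h2].
  rewrite !arc2 //; apply: pairP => /=; last exact: zC.
  by have -> : (val i <= x) = (val j <= x) by apply/idP/idP; lia.
have chin2 i k j : val i <= val k <= val j ->
  let b l := (@psi_gen n c d l).2 in
  (b j * (b i * b k) = b j * (b k * b i) /\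
   b j * (b k * b i) = b k * (b j * b i))%g.
  case: c cd arc2 {comm2} => [s _ _ _ b|y x cd arc2 ikj b].
    by split; [rewrite (zC _ (b i))|rewrite !mulgA (zC _ (b j))].
  case: (child_arc_lt cd) => xy _.
  rewrite /b !arc2 //; split; apply: pairP => /=.
  - case: (leqP (val i) x) => hi_; case: (leqP (val k) x) => hk //;
    case: (leqP (val j) x) => hj //; try lia.
    by rewrite !mulgA qp mul1g -mulgA qp mulg1.
  - by rewrite (zC _ (if val i == x then _ else _)).
  - case: (leqP (val i) x) => hi_; case: (leqP (val k) x) => hk //;
    case: (leqP (val j) x) => hj //; try lia.
    by rewrite qp mulg1 !mulgA qp mul1g.
  - by rewrite !mulgA (zC _ (if val j == x then _ else _)).
have chin r s : chinese_rel r s ->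
    (\prod_(i <- r) @psi_gen n c d i = \prod_(i <- s) @psi_gen n c d i)%g.
  have gb (l : {i | level_gens n d i}) : 0 < val l <= n.
    by case: l => l /=; case: (d) => [//|? ?] /andP[].
  case=> i k j ikj; rewrite !big_cons !big_nil !mulg1.
    have ik : 0 < val i <= val k by have := gb i; lia.
    have kj : val k <= val j <= n by have := gb j; lia.
    have [h _] := @level_gen_chinese n c d _ _ _ ik kj.
    have [h' _] := chin2 _ _ _ ikj.
    by apply: pairP => /=; rewrite ?psi_gen1.
  have ik : 0 < val i <= val k by have := gb i; lia.
  have kj : val k <= val j <= n by have := gb j; lia.
  have [_ h] := @level_gen_chinese n c d _ _ _ ik kj.
  have [_ h'] := chin2 _ _ _ ikj.
  by apply: pairP => /=; rewrite ?psi_gen1.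
case: d cd arc2 comm2 chin2 chin => [|e d] cd _ comm2 _ chin r s.
  exact: chin.
have := lo_le_hi (e :: d); have := hi_cons c (e :: d).
move=> hh lh.
have comm1 a b : (a < lo (e :: d)) && (b < lo (e :: d)) ||
    (hi (e :: d) < a) && (hi (e :: d) < b) ->
    (level_gen n [:: c, e & d] a * level_gen n [:: c, e & d] b =
     level_gen n [:: c, e & d] b * level_gen n [:: c, e & d] a)%g.
  have := lo_cons_le c e d => ll h.
  have [ha|/level_gen_out->] := boolP (level_gens n [:: c, e & d] a); last first.
    by rewrite mul1g mulg1.
  have [hb|/level_gen_out->] := boolP (level_gens n [:: c, e & d] b); last first.
    by rewrite mul1g mulg1.
  apply: level_gen_comm; move: ha hb; rewrite /level_gens; lia.
case=> [r' s' /chin //|i j hi_ hj|i j hi_ hj];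
  rewrite !big_cons !big_nil !mulg1; apply: pairP => /=; rewrite ?psi_gen1.
- by apply: comm1; rewrite hi_ hj.
- by apply: comm2 => //; rewrite hi_ hj.
- by apply: comm1; rewrite hi_ hj orbT.
- by apply: comm2 => //; rewrite hi_ hj orbT.
Qed.

Fixpoint kappa (n : nat) (d : diagram) :
    chinese_monoid n -> level_monoid n d * side_monoid d :=
  match d return chinese_monoid n -> level_monoid n d * side_monoid d with
  | [::] => fun x => (x, tt)
  | c :: d' => fun x =>
      let z := kappa d' x in
      let w := psi c z.1 in
      (w.1, (w.2, z.2))
  end.

Definition rho (n : nat) (d : diagram) (s t : chinese_monoid n) : Prop :=
  kappa d s = kappa d t.

Arguments rho : clear implicits.

Local Open Scope ring_scope.
Local Open Scope classical_set_scope.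

Definition congruence_ideal (K : fieldType) (M : monomType)
    (eta : M -> M -> Prop) : set {malg K[M]} :=
  [set f | exists r : seq (K * (M * M)),
     (forall z, z \in r -> eta z.2.1 z.2.2) /\
     f = \sum_(z <- r) z.1 *: (<< z.2.1 >> - << z.2.2 >>)].

Arguments congruence_ideal K {M} eta.

Definition two_sided_ideal (R : nzRingType) (I : set R) : Prop :=
  [/\ I 0, forall a b, I a -> I b -> I (a + b)
    & forall r a, I a -> I (r * a) /\ I (a * r)].

(* Prime ideals of a noncommutative ring (not "completely prime" ones). *)
Definition prime_two_sided_ideal (R : nzRingType) (P : set R) : Prop :=
  [/\ two_sided_ideal P, P <> setT
    & forall I J : set R, two_sided_ideal I -> two_sided_ideal J ->
        (forall a b, I a -> J b -> P (a * b)) -> I `<=` P \/ J `<=` P].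

(* Main.v *)
(* For a leaf d with arcs a_y a_x, rho(d) identifies two words exactly when they
   have the same content and, for every arc, the same number of unmatched p's
   after the substitution l |-> p (l <= x), l |-> q (l >= y), with qp = 1.

   Primality of I_rho(d): between two words s0, t0 one can insert a word w in the
   letters of the (nested) arcs which, in every bicyclic component, cancels the
   unmatched q's of s0 against the unmatched p's of t0.  If s0 and t0 have
   extremal content and then minimal numbers of unmatched p's in the supports of
   f and g, the class of s0 w t0 gets its contribution to f w g from (s0, t0)
   only.

   Descent: a prime P contains [a_j,a_l] for all j, l >= k or for all j, l <= k,
   because [a_j,a_l] w [a_i,a_k'] = 0 whenever i, k' <= k <= j, l.  Hence P
   contains the ideal of some C_{s+1,s}, and it remains to enlarge the interval.
   Put x = u-1, y = v+1.  In C_{u,v} the element [x,a_j] w [a_i,y] is 0 unless w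
   is a Dyck word (low letters matched with high ones), since an unmatched low
   letter can be moved to the front, where it is killed by [x,a_j], and dually;
   a Dyck word equals y^b w' x^a, with w' free of x and y.  So [x,a_j] w [a_i,y]
   only depends on the image of w under the arc congruence for a_y a_x, that is,
   I_x I_arc I_y = 0 for the ideals of the dot a_x, the arc and the dot a_y.
   When the tree does not have the dot child in question, the ideal of some
   other vertex with the same (larger) interval is contained in that of the dot. *)
Require Import Defs.
From HB Require Import structures.
From mathcomp Require Import all_boot all_algebra.
From mathcomp Require Import finmap.
From mathcomp Require Import boolp classical_sets.
From mathcomp.multinomials Require Import monalg.
From mathcomp Require Import zify.

Set Implicit Arguments.
Unset Strict Implicit.
Unset Printing Implicit Defensive.

Import GRing.Theory.

Local Open Scope classical_set_scope.

(** * Words and the bicyclic monoid *)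

(* The pair (a, b) encodes the element p^a q^b of the bicyclic monoid. *)
Definition bmul (s t : nat * nat) : nat * nat :=
  (s.1 + (t.1 - s.2), t.2 + (s.2 - t.1)).

(** For [x < y], letters up to [x] become p, letters from [y] on become q, and those strictly
    between become 1. So [bc] counts the unmatched p's and the unmatched q's, a q being matched with
    a later p. *)
Definition bval (x y l : nat) : nat * nat := (nat_of_bool (l <= x), nat_of_bool (y <= l)).

Definition bc (x y : nat) (w : seq nat) : nat * nat :=
  foldr (fun l => bmul (bval x y l)) (0, 0) w.

Lemma bmulA : associative bmul.
Proof. by move=> [a b] [c d] [e f]; rewrite /bmul /=; congr pair; lia. Qed.

Lemma bmul1s s : bmul (0, 0) s = s.
Proof. by case: s => a b; rewrite /bmul /=; congr pair; lia. Qed.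

Lemma bmuls1 s : bmul s (0, 0) = s.
Proof. by case: s => a b; rewrite /bmul /=; congr pair; lia. Qed.

Lemma bc_cat x y w w' : bc x y (w ++ w') = bmul (bc x y w) (bc x y w').
Proof. by elim: w => [|l w IH] /=; rewrite ?bmul1s // IH bmulA. Qed.

Lemma bc_rcons x y w l : bc x y (rcons w l) = bmul (bc x y w) (bval x y l).
Proof. by rewrite -cats1 bc_cat /= bmuls1. Qed.

(** The reduction qp = 1 removes one p and one q, so their difference is invariant. Hence the
    content and the unmatched p's determine the unmatched q's. *)
Lemma bc_diff x y w :
  (bc x y w).1 + count (fun l => y <= l) w =
  (bc x y w).2 + count (fun l => l <= x) w.
Proof.
elim: w => //= l w; case: (bc x y w) => a b /=.
by rewrite /bmul /bval /=; case: (leqP l x); case: (leqP y l); lia.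
Qed.

(** The deleted letters are all q's: deleting one may free a p but cannot create an unmatched q. *)
Lemma bc_removeP (a : pred nat) x y w : (forall l, ~~ a l -> y <= l) -> x < y ->
  (bc x y w).1 <= (bc x y (filter a w)).1 /\
  (bc x y (filter a w)).2 <= (bc x y w).2.
Proof.
move=> ah xy; elim: w => //= l w [].
case: (bc x y w) => a1 b1; case: ifPn => [al|/ah yl] /=.
  case: (bc x y (filter a w)) => a2 b2 /=; rewrite /bmul /=; lia.
case: (bc x y (filter a w)) => a2 b2 /=; rewrite /bmul /bval /=.
have -> : l <= x = false by lia.
by rewrite yl /=; lia.
Qed.

(** * Products over words and unmatched letters under the Chinese relations *)

Local Open Scope quotient_scope.
Local Open Scope group_scope.

Definition ev (C : monoidType) (F : nat -> C) (w : seq nat) : C :=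
  \prod_(l <- w) F l.

Lemma ev_nil (C : monoidType) (F : nat -> C) : ev F [::] = 1.
Proof. exact: big_nil. Qed.

Lemma ev_cons (C : monoidType) (F : nat -> C) l w : ev F (l :: w) = F l * ev F w.
Proof. exact: big_cons. Qed.

Lemma ev_cat (C : monoidType) (F : nat -> C) w w' :
  ev F (w ++ w') = ev F w * ev F w'.
Proof. exact: big_cat. Qed.

Lemma ev_rcons (C : monoidType) (F : nat -> C) w l :
  ev F (rcons w l) = ev F w * F l.
Proof. by rewrite -cats1 ev_cat ev_cons ev_nil mulg1. Qed.

Definition chinese_family (A : pred nat) (C : monoidType) (F : nat -> C) :=
  forall i k j, A i -> A k -> A j -> i <= k <= j ->
  F j * (F i * F k) = F j * (F k * F i) /\
  F j * (F k * F i) = F k * (F j * F i).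

Section Unmatched.
Variables (A : pred nat) (C : monoidType) (F : nat -> C) (x y : nat).
Hypothesis xy : x < y.
Hypothesis chin : chinese_family A F.

Definition outer_word := all (fun l => A l && ((l <= x) || (y <= l))).

Let low l := A l && (l <= x).
Let high l := A l && (y <= l).

(** The larger of the two low letters passes to the front. *)
Lemma high_low_low h l k : high h -> low l -> low k ->
  exists l' k', [/\ low l', low k' & F h * (F l * F k) = F l' * (F h * F k')].
Proof.
move=> /andP[Ah yh] /[dup] Ll /andP[Al lx] /[dup] Lk /andP[Ak kx].
have [lk|kl] := leqP l k.
  have [e1 e2] := @chin l k h Al Ak Ah ltac:(lia).
  by exists k, l; split; rewrite // e1.
have [e1 e2] := @chin k l h Ak Al Ah ltac:(lia).
by exists l, k; split.
Qed.

(** The smaller of the two high letters passes to the end. *)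
Lemma high_high_low h k l : high h -> high k -> low l ->
  exists h' k', [/\ high h', high k' & F h * (F k * F l) = F h' * (F l * F k')].
Proof.
move=> /[dup] Hh /andP[Ah yh] /[dup] Hk /andP[Ak yk] /andP[Al lx].
have [hk|kh] := leqP h k.
  have [e1 e2] := @chin l h k Al Ah Ak ltac:(lia).
  by exists k, h; split; rewrite // -e2 e1.
have [e1 e2] := @chin l k h Al Ak Ah ltac:(lia).
by exists h, k; split; rewrite // e1.
Qed.

(* A high letter in front of two extracted low letters can be moved between
   them, so an unmatched low letter can always be brought to the front. *)
Lemma low_first w : outer_word w -> 0 < (bc x y w).1 ->
  exists l w', [/\ low l, outer_word w', ev F w = F l * ev F w',
    (size w' < size w)%N & bc x y w = ((bc x y w').1.+1, (bc x y w').2)].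
Proof.
elim: {w}_.+1 {-2}w (ltnSn (size w)) => // n IH [|c w] //= sw /andP[cA wA].
have lx l : low l -> bval x y l = (1, 0)%N.
  by move=> /andP[_ lx]; rewrite /bval lx; congr pair; lia.
have [cx|cx] := leqP c x.
  move=> _; exists c, w; rewrite ev_cons; split => //.
    by case/andP: cA => cA _; rewrite /low cA cx.
  by rewrite lx /low ?cx; [case: (bc x y w) => a b; rewrite /bmul /=; congr pair; lia
    | case/andP: cA => ->].
have hc : high c by rewrite /high; case/andP: cA => -> /=; lia.
have -> : bval x y c = (0, 1)%N.
  by rewrite /bval; case/andP: hc => _ ->; congr pair; lia.
rewrite /bmul /= => a0.
(* The high letter [c] absorbs one unmatched p, so [w] has at least two. The second one is extracted
   from [w1], which is why the induction is on length. *)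
have [l [w1 [Ll w1A e1 s1 b1]]] := IH w ltac:(lia) wA ltac:(lia).
have [k [w2 [Lk w2A e2 s2 b2]]] := IH w1 ltac:(lia) w1A ltac:(rewrite b1 /= in a0; lia).
have [l' [k' [Ll' Lk' e3]]] := high_low_low hc Ll Lk.
exists l', [:: c, k' & w2]; split => //=.
- by case/andP: Lk' => -> ->; rewrite cA.
- by rewrite !ev_cons e1 e2 !mulgA; congr (_ * _); rewrite -!mulgA.
- by rewrite !ltnS (leq_ltn_trans s2).
case/andP: Lk' => _ kx; case/andP: hc => _ yc.
by rewrite b1 b2 /bmul /bval /=; congr pair; lia.
Qed.

(** Mirror image of [low_first]: a final low letter is passed by means of [high_high_low]. *)
Lemma high_last w : outer_word w -> 0 < (bc x y w).2 ->
  exists h w', [/\ high h, outer_word w', ev F w = ev F w' * F h,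
    (size w' < size w)%N & bc x y w = ((bc x y w').1, (bc x y w').2.+1)].
Proof.
elim: {w}_.+1 {-2}w (ltnSn (size w)) => // n IH w sw.
case/lastP: w sw => [|w c] // sw; rewrite /outer_word all_rcons => /andP[cA wA].
have hy l : high l -> bval x y l = (0, 1)%N.
  by move=> /andP[_ yl]; rewrite /bval yl; congr pair; lia.
rewrite size_rcons in sw *; rewrite !bc_rcons.
have [yc|yc] := leqP y c.
  move=> _; exists c, w; rewrite ev_rcons; split => //.
    by case/andP: cA => cA _; rewrite /high cA yc.
  by rewrite hy /high ?yc; [case: (bc x y w) => a b; rewrite /bmul /=; congr pair; lia
    | case/andP: cA => ->].
have lc : low c by rewrite /low; case/andP: cA => -> /=; lia.
have -> : bval x y c = (1, 0)%N.
  by rewrite /bval; case/andP: lc => _ ->; congr pair; lia.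
rewrite /bmul /= => b0.
have [k [w1 [Lk w1A e1 s1 b1]]] := IH w ltac:(lia) wA ltac:(lia).
have [h [w2 [Lh w2A e2 s2 b2]]] := IH w1 ltac:(lia) w1A ltac:(rewrite b1 /= in b0; lia).
have [h' [k' [Lh' Lk' e3]]] := high_high_low Lh Lk lc.
exists k', (rcons (rcons w2 h') c); split => //=.
- rewrite /outer_word !all_rcons cA; move: w2A; rewrite /outer_word => ->.
  by case/andP: Lh' => -> ->; rewrite orbT.
- by rewrite !ev_rcons e1 e2 -!mulgA e3.
- by rewrite !size_rcons !ltnS (leq_ltn_trans s2).
case/andP: Lh' => _ hy'; case/andP: lc => _ cx.
by rewrite !bc_rcons b1 b2 /bmul /bval /=; congr pair; lia.
Qed.

End Unmatched.

(** * Commutators in Chinese families *)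

Section ChineseFamily.
Variables (A : pred nat) (C : monoidType) (F : nat -> C).
Hypothesis chin : chinese_family A F.

Lemma chinese_swap_left j l a : A j -> A l -> A a -> a <= j -> a <= l ->
  F j * (F l * F a) = F l * (F j * F a).
Proof.
move=> Aj Al Aa aj al; have [jl|lj] := leqP j l.
  by have [_ ->] := @chin a j l Aa Aj Al ltac:(lia).
by have [_ ->] := @chin a l j Aa Al Aj ltac:(lia).
Qed.

Lemma chinese_swap_right i k a : A i -> A k -> A a -> i <= a -> k <= a ->
  F a * (F i * F k) = F a * (F k * F i).
Proof.
move=> Ai Ak Aa ia ka; have [ik|ki] := leqP i k.
  by have [-> _] := @chin i k a Ai Ak Aa ltac:(lia).
by have [-> _] := @chin k i a Ak Ai Aa ltac:(lia).
Qed.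

(** Either alternative makes [j,l] W [i,k] vanish. If [w] has no unmatched q, the first letter after
    it is an unmatched p, and some letter up to [t] reaches the front, where it lets [j] and [l]
    swap. Otherwise a letter above [t] reaches the end of [W] and lets [i] and [k] swap. *)
Lemma commutator_product t i k j l w : A i -> A k -> A j -> A l ->
    i <= t -> k <= t -> t <= j -> t <= l -> all A w ->
  let E a b := F a * F b in let W := ev F w in
  (forall z, z = E i k \/ z = E k i -> E j l * (W * z) = E l j * (W * z)) \/
  (forall z, E j l = z \/ E l j = z -> z * (W * E i k) = z * (W * E k i)).
Proof.
move=> Ai Ak Aj Al it kt tj tl Aw E W.
have lt : t < t.+1 by [].
(* The cut lies between [t] and [t.+1], so every letter is outer. *)
have okA s : all A s -> outer_word A t t.+1 s.
  by apply: sub_all => c ->; case: (leqP c t).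
have [b0|b0] := posnP (bc t t.+1 w).2.
  left=> z zE.
  have [c [c' [cA c't zc]]] : exists c c', [/\ A c, c <= t & z = F c * F c'].
    by case: zE => ->; [exists i, k | exists k, i].
  have cw : outer_word A t t.+1 (rcons w c).
    by apply: okA; rewrite all_rcons cA.
  have [|a [w' [/andP[Aa at_] _ e _ _]]] := low_first lt chin cw.
    by rewrite bc_rcons /bmul b0 /bval c't /=; lia.
  rewrite zc [W * _]mulgA -ev_rcons e /E !mulgA; congr (_ * _); congr (_ * _).
  by rewrite -!mulgA chinese_swap_left //; lia.
right=> z zE.
have [a [w' [/andP[Aa at_] _ e _ _]]] := high_last lt chin (okA _ Aw) b0.
rewrite /W e /E -!mulgA; congr (_ * _); congr (_ * _).
by rewrite chinese_swap_right //; lia.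
Qed.

Section Core.
Variables (x y : nat).
Hypotheses (xy : x < y) (Ax : A x) (Ay : A y).
Let low l := A l && (l <= x).
Let high l := A l && (y <= l).
Hypothesis low_comm : forall l l', low l -> low l' -> commute (F l) (F l').
Hypothesis high_comm : forall l l', high l -> high l' -> commute (F l) (F l').

(** A low last letter [c] is matched, so a high letter [h] can be placed just before it. As [y] is
    the least high letter, [y <= h], and behind [F h] the letters [c] and [y] may be swapped. *)
Lemma no_unmatched_low_comm w : outer_word A x y w -> (bc x y w).1 = 0%N ->
  commute (ev F w) (F y).
Proof.
have Hy : high y by rewrite /high Ay leqnn.
elim/last_ind: w => [|w c IH]; first by rewrite ev_nil => *; exact: commute_sym (commute1 _).
rewrite /outer_word all_rcons => /andP[/andP[Ac cxy] wA].
rewrite bc_rcons /bmul /bval /= => b0; rewrite /commute ev_rcons.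
have {}IH : commute (ev F w) (F y) by apply: IH => //; lia.
have [cx|cx] := leqP c x.
  have [|h [w' [/andP[Ah yh] _ e _ _]]] := high_last xy chin wA.
    by move: b0; rewrite cx; lia.
  rewrite mulgA -IH e -!mulgA; congr (_ * _).
  by rewrite chinese_swap_right //; lia.
have Hc : high c by rewrite /high Ac; lia.
by rewrite -mulgA (high_comm Hc Hy) !mulgA IH.
Qed.

(** Mirror image, with [x] as the greatest low letter. *)
Lemma no_unmatched_high_comm w : outer_word A x y w -> (bc x y w).2 = 0%N ->
  commute (F x) (ev F w).
Proof.
have Lx : low x by rewrite /low Ax leqnn.
elim: w => [|c w IH]; first by rewrite ev_nil => *; exact: commute1.
rewrite /outer_word /= => /andP[/andP[Ac cxy] wA].
rewrite /bmul /bval /= => b0; rewrite /commute ev_cons.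
have {}IH : commute (F x) (ev F w) by apply: IH => //; lia.
have [yc|yc] := leqP y c.
  have [|h [w' [/andP[Ah yh] _ e _ _]]] := low_first xy chin wA.
    by move: b0; rewrite yc; lia.
  rewrite -mulgA -IH e !mulgA; congr (_ * _).
  by rewrite -!mulgA chinese_swap_left //; lia.
have Lc : low c by rewrite /low Ac; lia.
by rewrite mulgA (low_comm Lx Lc) -!mulgA IH.
Qed.

Lemma extract_high w : outer_word A x y w -> (bc x y w).1 = 0%N ->
  ev F w = F y ^+ count_mem y w * ev F (filter (predC1 y) w).
Proof.
elim/last_ind: w => [|w c IH]; first by rewrite ev_nil mulg1.
rewrite /outer_word all_rcons => /andP[/andP[Ac cxy] wA].
rewrite bc_rcons /bmul /bval /= => b0.
have b1 : (bc x y w).1 = 0%N by lia.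
rewrite filter_rcons -cats1 count_cat /= addn0 cats1 ev_rcons.
case: eqVneq => [->|_] /=.
  by rewrite (no_unmatched_low_comm wA b1) IH // addn1 expgS mulgA.
by rewrite addn0 ev_rcons mulgA -IH.
Qed.

Lemma extract_low w : outer_word A x y w -> (bc x y w).2 = 0%N ->
  ev F w = ev F (filter (predC1 x) w) * F x ^+ count_mem x w.
Proof.
elim: w => [|c w IH]; first by rewrite ev_nil mulg1.
rewrite /outer_word /= => /andP[/andP[Ac cxy] wA].
rewrite /bmul /bval /= => b0.
have b1 : (bc x y w).2 = 0%N by lia.
rewrite ev_cons; case: eqVneq => [->|_] /=.
  by rewrite (no_unmatched_high_comm wA b1) IH // add1n expgSr mulgA.
by rewrite add0n ev_cons -mulgA -IH.
Qed.

(** Deleting the letters [y] creates no unmatched q, so [extract_low] still applies after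
    [extract_high]. *)
Lemma dyck_normal_form w : outer_word A x y w -> bc x y w = (0, 0)%N ->
  ev F w = F y ^+ count_mem y w *
    (ev F (filter (predI (predC1 x) (predC1 y)) w) * F x ^+ count_mem x w).
Proof.
move=> wA b0; rewrite extract_high ?b0 //; congr (_ * _).
have [|_ b2] := @bc_removeP (predC1 y) x y w _ xy; first by move=> l /=; lia.
rewrite extract_low; first last.
- by move: b2; rewrite b0 /=; lia.
- rewrite /outer_word all_filter; apply: sub_all wA => l /=; by case: (l != y).
rewrite -filter_predI count_filter; congr (_ * _ ^+ _).
by apply: eq_count => l /=; case: eqVneq => //= ->; lia.
Qed.

(** The value of the additive extension of [f] to the monoid ring on [x,j] W [i,y]. The map [f] is
    arbitrary since it will be a choice of representatives, which need not respect products. *)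
Definition double_commutator (V : zmodType) (f : C -> V) i j (W : C) : V :=
  let g z := (f (F x * F j * (W * z))%g - f (F j * F x * (W * z))%g)%R in
  (g (F i * F y)%g - g (F y * F i)%g)%R.

Lemma double_commutator_bc (V : zmodType) (f : C -> V) i j w :
    low i -> high j -> outer_word A x y w -> bc x y w <> (0, 0)%N ->
  double_commutator f i j (ev F w) = 0%R.
Proof.
move=> /andP[Ai ix] /andP[Aj yj] wA b0; rewrite /double_commutator.
have [a0|a0] := posnP (bc x y w).1.
  have [|h [w' [/andP[Ah yh] _ -> _ _]]] := high_last xy chin wA.
    by case: (bc x y w) b0 a0 => [[|?] [|?]].
  by rewrite -!mulgA chinese_swap_right ?subrr //; lia.
have [l [w' [/andP[Al lx] _ -> _ _]]] := low_first xy chin wA a0.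
have e : F x * F j * F l = F j * F x * F l.
  by rewrite -!mulgA (chinese_swap_left Ax Aj Al) //; lia.
by rewrite !mulgA e !subrr.
Qed.

Lemma double_commutator_eq (V : zmodType) (f : C -> V) i j w w' : low i -> high j ->
    outer_word A x y w -> outer_word A x y w' ->
    count_mem x w = count_mem x w' -> count_mem y w = count_mem y w' ->
    bc x y w = bc x y w' ->
    ev F (filter (predI (predC1 x) (predC1 y)) w) =
    ev F (filter (predI (predC1 x) (predC1 y)) w') ->
  double_commutator f i j (ev F w) = double_commutator f i j (ev F w').
Proof.
move=> Li Hj wA wA' ex ey eb ef.
have [b0|/eqP b0] := eqVneq (bc x y w) (0, 0)%N.
  have b0' : bc x y w' = (0, 0)%N by rewrite -eb.
  by rewrite (dyck_normal_form wA b0) (dyck_normal_form wA' b0') ex ey ef.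
by rewrite !double_commutator_bc -?eb.
Qed.

End Core.
End ChineseFamily.

(** * The tree of diagrams *)

(** The fold in [lo] starts from the first used index, which changes when a piece is added; any
    member of the list serves equally well. *)
Lemma foldr_minn_min a b s : b \in s ->
  foldr minn a s = minn a (foldr minn b s).
Proof.
move=> bs.
have le e f : foldr minn (minn e f) s = minn e (foldr minn f s).
  by elim: s {bs} => //= g t ->; lia.
have : foldr minn a s <= b.
  by elim: s bs {le} => // c s IH; rewrite inE => /predU1P[->|/IH] /=; lia.
by move=> /minn_idPr <-; rewrite -!le minnC.
Qed.

Lemma lo_cons c d : d <> [::] -> lo (c :: d) = foldr minn (lo d) (piece_indices c).
Proof.
move=> d0; rewrite /lo {2}/used /= -/(used d) foldr_cat.
have hd : head 0%N (used d) \in used d.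
  by case: d d0 => //= -[s|y x] d _; rewrite mem_head.
rewrite (@foldr_minn_min _ (head 0%N (used d)) (used d)) //.
by move: (foldr _ _ (used d)) => m; case: c => [s|y x] /=; lia.
Qed.

Lemma hi_consE c d : hi (c :: d) = foldr maxn (hi d) (piece_indices c).
Proof. by rewrite /hi /used /= foldr_cat. Qed.

Lemma lo_dot1 s : lo [:: PDot s] = s. Proof. by rewrite /lo /=; lia. Qed.
Lemma hi_dot1 s : hi [:: PDot s] = s. Proof. by rewrite /hi /=; lia. Qed.
Lemma lo_arc1 y x : lo [:: PArc y x] = minn y x.
Proof. by rewrite /lo /=; lia. Qed.
Lemma hi_arc1 y x : hi [:: PArc y x] = maxn y x.
Proof. by rewrite /hi /=; lia. Qed.

Definition lohiE := (lo_dot1, hi_dot1, lo_arc1, hi_arc1, hi_consE).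

(** The conditions on the last added piece are dropped, as the interval and the arcs of the child do
    not depend on them. *)
Lemma child_cases n d e : child n d e -> d <> [::] ->
  exists2 c, e = c :: d & ~~ has_end_arc n d /\
  [\/ c = PArc (hi d + 1) (lo d - 1),
     c = PDot (hi d + 1) /\ hi d + 1 < n |
     c = PDot (lo d - 1) /\ 1 < lo d - 1].
Proof.
case: d e / => [s _ []|s _ []|d _ h|d y x d' _ h h'|d y x d' _ h h'
  |d d' _ _ h h'|d d' _ _ h h'] // _; eexists; try reflexivity; split=> //.
- exact: Or31.
- exact: Or32.
- exact: Or33.
- exact: Or32.
- exact: Or33.
Qed.

(** Dots are added strictly inside the range, so only an arc can reach [1] or [n]; without such an
    arc there is room on both sides. *)
Lemma in_tree_bounds n d : in_tree n d -> d <> [::] ->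
  [/\ 0 < lo d, hi d <= n & ~~ has_end_arc n d -> 1 < lo d /\ hi d < n].
Proof.
elim=> // {}d e td IH de _; have lh := lo_le_hi d.
have [d0|d0] : d = [::] \/ d <> [::] by case: (d); [left | right].
  by subst; inversion de; subst => //; rewrite /has_end_arc /= ?lohiE ?inE;
    split; lia.
have [l1 l2 l3] := IH d0.
have [c -> [/l3 {l3}[l3 l4] cE]] := child_cases de d0.
rewrite lo_cons // hi_consE [has_end_arc _ _]/=.
by case: cE => [->|[-> ?]|[-> ?]] /=; rewrite ?inE; split; lia.
Qed.

Definition arcs (d : diagram) : seq (nat * nat) :=
  pmap (fun c => if c is PArc y x then Some (x, y) else None) d.

Lemma child_gens n c d : in_tree n d -> child n d (c :: d) -> forall l,
  level_gens n d l = level_gens n (c :: d) l || (l \in piece_indices c).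
Proof.
move=> td cd l; have lh := lo_le_hi d.
have [d0|d0] : d = [::] \/ d <> [::] by case: (d); [left | right].
  by subst; inversion cd; subst => //; rewrite /= /lo /hi /= ?inE; lia.
have [l1 l2 l3] := in_tree_bounds td d0.
rewrite [level_gens n (c :: d) l]/= lo_cons // hi_consE.
have -> : level_gens n d l = (0 < l <= n) && ((l < lo d) || (hi d < l)).
  by case: d d0 {td cd lh l1 l2 l3}.
have [_ [<-] [/l3 {l3}[l3 l4] cE]] := child_cases cd d0.
by case: cE => [->|[-> ?]|[-> ?]] /=; rewrite ?inE; lia.
Qed.

Lemma child_arc_gens n y x d : in_tree n d -> child n d (PArc y x :: d) ->
  [/\ 0 < x, x < y, y <= n & forall l,
    level_gens n d l = (0 < l <= n) && ((l <= x) || (y <= l))].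
Proof.
move=> td cd; have lh := lo_le_hi d.
have [d0|d0] : d = [::] \/ d <> [::] by case: (d); [left | right].
  by subst; inversion cd; subst => //; split=> *; rewrite /=; lia.
have [l1 l2 l3] := in_tree_bounds td d0.
have e l : level_gens n d l = (0 < l <= n) && ((l < lo d) || (hi d < l)).
  by case: d d0 {td cd lh l1 l2 l3}.
have [_ [<-] [/l3 {l3}[l3 l4] cE]] := child_cases cd d0.
by case: cE => [[-> ->]|[]|[]] //; split=> *; rewrite ?e; lia.
Qed.

Lemma child_dot_gens n s d : in_tree n d -> child n d (PDot s :: d) ->
  level_gens n d s.
Proof. by move=> td cd; rewrite (child_gens td cd) !inE eqxx orbT. Qed.

(** * The monoids C_{u,v} *)

Lemma prod_pres_gen (X : choiceType) (R : seq X -> seq X -> Prop) r s :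
  R r s -> \prod_(l <- r) pres_gen R l = \prod_(l <- s) pres_gen R l.
Proof. by move=> rs; rewrite !pres_genM; apply/pres_eqP/pres_rel0. Qed.

Definition outgens n u v : pred nat := fun i => (0 < i <= n) && ((i < u) || (v < i)).

Definition outmon n u v : monoidType :=
  pres (@interval_rel (outgens n u v) u v).

(* [level_gen n d] is convertible to [outgen n (lo d) (hi d)] for [d <> [::]];
   the interval {u, ..., v} is also allowed to be empty here. *)
Definition outgen n u v (i : nat) : outmon n u v :=
  if insub i is Some x then pres_gen (@interval_rel (outgens n u v) u v) x else 1.

Section Outmon.
Variables (n u v : nat).

Lemma outgenE (l : {i | outgens n u v i}) :
  outgen n u v (val l) = pres_gen (@interval_rel (outgens n u v) u v) l.
Proof. by rewrite /outgen valK. Qed.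

Lemma outgen_out l : ~~ outgens n u v l -> outgen n u v l = 1.
Proof. by rewrite /outgen => h; rewrite insubN. Qed.

Lemma ev_outgen (w : seq {i | outgens n u v i}) :
  ev (outgen n u v) (map val w) = \pi_(pres (@interval_rel (outgens n u v) u v)) w.
Proof.
rewrite -pres_genM /ev big_map; apply: eq_bigr => l _; exact: outgenE.
Qed.

Lemma outgens_lift w : all (outgens n u v) w ->
  exists w' : seq {i | outgens n u v i}, w = map val w'.
Proof.
elim: w => [|l w IH] /=; first by exists [::].
by case/andP=> hl /IH[w' ->]; exists (exist _ l hl :: w').
Qed.

Lemma ev_outgen_rel (r s : seq {i | outgens n u v i}) : interval_rel u v r s ->
  ev (outgen n u v) (map val r) = ev (outgen n u v) (map val s).
Proof. by move=> rs; rewrite !ev_outgen; apply/pres_eqP/pres_rel0. Qed.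

Lemma outgen_chinese : chinese_family (outgens n u v) (outgen n u v).
Proof.
move=> i k j hi_ hk hj ikj.
pose xi : {i | outgens n u v i} := exist _ i hi_.
pose xk : {i | outgens n u v i} := exist _ k hk.
pose xj : {i | outgens n u v i} := exist _ j hj.
have h1 := @ev_outgen_rel [:: xj; xi; xk] [:: xj; xk; xi].
have h2 := @ev_outgen_rel [:: xj; xk; xi] [:: xk; xj; xi].
rewrite /= !ev_cons ev_nil !mulg1 in h1 h2; split; [apply: h1|apply: h2];
  apply: interval_chinese; [exact: chinese_jik | exact: chinese_jki].
Qed.

Lemma outgen_low_comm l l' : outgens n u v l && (l < u) ->
  outgens n u v l' && (l' < u) -> commute (outgen n u v l) (outgen n u v l').
Proof.
move=> /andP[hl lu] /andP[hl' lu'].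
have := @ev_outgen_rel [:: exist _ l hl; exist _ l' hl']
  [:: exist _ l' hl'; exist _ l hl].
by rewrite /= !ev_cons ev_nil !mulg1; apply; apply: interval_comm_lo.
Qed.

Lemma outgen_high_comm l l' : outgens n u v l && (v < l) ->
  outgens n u v l' && (v < l') -> commute (outgen n u v l) (outgen n u v l').
Proof.
move=> /andP[hl lu] /andP[hl' lu'].
have := @ev_outgen_rel [:: exist _ l hl; exist _ l' hl']
  [:: exist _ l' hl'; exist _ l hl].
by rewrite /= !ev_cons ev_nil !mulg1; apply; apply: interval_comm_hi.
Qed.

Lemma ev_outgen_filter w : ev (outgen n u v) (filter (outgens n u v) w) =
  ev (outgen n u v) w.
Proof.
elim: w => //= l w IH; case: ifPn => h; rewrite !ev_cons IH //.
by rewrite outgen_out // mul1g.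
Qed.

(** The universal property of C_{u,v}, in terms of words. *)
Lemma outmon_lift (N : monoidType) (f : nat -> N) w w' :
    chinese_family (outgens n u v) f ->
    (forall l l', outgens n u v l && (l < u) -> outgens n u v l' && (l' < u) ->
      commute (f l) (f l')) ->
    (forall l l', outgens n u v l && (v < l) -> outgens n u v l' && (v < l') ->
      commute (f l) (f l')) ->
    all (outgens n u v) w -> all (outgens n u v) w' ->
  ev (outgen n u v) w = ev (outgen n u v) w' -> ev f w = ev f w'.
Proof.
move=> fc fl fh /outgens_lift[r ->] /outgens_lift[s ->].
rewrite !ev_outgen => /pres_eqP rs; rewrite /ev !big_map.
apply: pres_cong_prod rs => {}r {}s [r' s' [i k j|i k j]|i j|i j].
- move=> ikj; rewrite !big_cons !big_nil !mulg1.
  by have [] := fc _ _ _ (valP i) (valP k) (valP j) ikj.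
- move=> ikj; rewrite !big_cons !big_nil !mulg1.
  by have [] := fc _ _ _ (valP i) (valP k) (valP j) ikj.
- move=> iu ju; rewrite !big_cons !big_nil !mulg1.
  by apply: fl; rewrite ?iu ?ju ?(valP i) ?(valP j).
- move=> iu ju; rewrite !big_cons !big_nil !mulg1.
  by apply: fh; rewrite ?iu ?ju ?(valP i) ?(valP j).
Qed.

(** The relations preserve multiplicities: the indicator of [l], with values in the commutative
    monoid N, lifts to C_{u,v}. *)
Lemma ev_outgen_count w w' : ev (outgen n u v) w = ev (outgen n u v) w' ->
  forall l, outgens n u v l -> count_mem l w = count_mem l w'.
Proof.
move=> e l hl.
pose f i : Algebra.to_multiplicative nat := nat_of_bool (i == l).
have fC i j : commute (f i) (f j) by exact: (@addrC nat).
have fE s : ev f s = count_mem l s.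
  by elim: s => [|c s IH]; rewrite ?ev_nil // ev_cons IH.
have cE s : count_mem l (filter (outgens n u v) s) = count_mem l s.
  by rewrite count_filter; apply: eq_count => i /=; case: eqVneq => // ->.
rewrite -cE -[RHS]cE -!fE. apply: (@outmon_lift _ f).
- by move=> i k j *; rewrite (fC i k) ?mulgA (fC j k).
- by move=> *; apply: fC.
- by move=> *; apply: fC.
- exact: filter_all.
- exact: filter_all.
- by rewrite !ev_outgen_filter.
Qed.

End Outmon.

(** The larger interval has fewer generators and fewer commutation relations, so a_l maps to a_l
    from C_{u',v'} to C_{u,v}. *)
Lemma ev_outgen_sub n u v u' v' w w' : u' <= u -> v <= v' ->
    all (outgens n u' v') w -> all (outgens n u' v') w' ->
  ev (outgen n u' v') w = ev (outgen n u' v') w' ->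
  ev (outgen n u v) w = ev (outgen n u v) w'.
Proof.
move=> uu vv; apply: outmon_lift.
- move=> i k j; rewrite /outgens => hi_ hk hj.
  by apply: outgen_chinese; rewrite /outgens; lia.
- by move=> i j hi_ hj; apply: outgen_low_comm; rewrite /outgens in hi_ hj *; lia.
- by move=> i j hi_ hj; apply: outgen_high_comm; rewrite /outgens in hi_ hj *; lia.
Qed.

(** * Normal forms in the bicyclic monoid *)

Definition bicyclic_of (s : nat * nat) : bicyclic :=
  bicyclic_p ^+ s.1 * bicyclic_q ^+ s.2.

Lemma bicyclic_qp1 : bicyclic_q * bicyclic_p = 1.
Proof.
have := prod_pres_gen bicyclic_qp.
by rewrite !big_cons !big_nil mulg1.
Qed.

Lemma bicyclic_ofM s t : bicyclic_of (bmul s t) = bicyclic_of s * bicyclic_of t.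
Proof.
case: s t => a b [c d]; rewrite /bicyclic_of /bmul /=.
have -> : bicyclic_p ^+ a * bicyclic_q ^+ b * (bicyclic_p ^+ c * bicyclic_q ^+ d)
  = bicyclic_p ^+ a * (bicyclic_q ^+ b * bicyclic_p ^+ c) * bicyclic_q ^+ d.
  by rewrite !mulgA.
have -> : bicyclic_q ^+ b * bicyclic_p ^+ c =
    bicyclic_p ^+ (c - b) * bicyclic_q ^+ (b - c).
  elim: b c => [|b IH] [|c]; rewrite ?subn0 ?sub0n ?mul1g ?mulg1 //.
  rewrite !subSS -IH expgSr expgS -mulgA (mulgA bicyclic_q).
  by rewrite bicyclic_qp1 mul1g.
by rewrite !mulgA -expgnDr -mulgA -expgnDr [(d + _)%N]addnC.
Qed.

(** Evaluating words in pairs under [bmul] respects qp = 1 and recovers the exponents. *)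
Lemma bicyclic_of_inj : injective bicyclic_of.
Proof.
pose v (b : bool) : nat * nat := if b then (1, 0)%N else (0, 1)%N.
pose f := foldr (fun b => bmul (v b)) (0, 0)%N.
have fcat r s : f (r ++ s) = bmul (f r) (f s).
  by elim: r => [|b r IH] /=; rewrite ?bmul1s // IH bmulA.
have fE s : f (nseq s.1 true ++ nseq s.2 false) = s.
  rewrite fcat; case: s => a b /=.
  have -> : f (nseq a true) = (a, 0)%N.
    by elim: a => //= a ->; rewrite /bmul /=; congr pair; lia.
  have -> : f (nseq b false) = (0, b)%N.
    by elim: b => //= b ->; rewrite /bmul /=; congr pair; lia.
  by rewrite /bmul /=; congr pair; lia.
have ofE s : bicyclic_of s =
    \pi_(pres bicyclic_rel) (nseq s.1 true ++ nseq s.2 false).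
  rewrite -pres_genM big_cat /= !big_nseq /bicyclic_of.
  have it (g : bicyclic) k : iter k ( *%g g) 1 = g ^+ k.
    by elim: k => //= k ->; rewrite expgS.
  by rewrite !it.
move=> s t; rewrite !ofE => /pres_eqP st; rewrite -[s]fE -[t]fE.
elim: st => [r1 r2 r r' [] | | |] //=; last by move=> ? ? ? _ -> _ ->.
rewrite !fcat; congr bmul; rewrite /= bmulA; exact: bmul1s.
Qed.

(** * The congruences rho(d) *)

Lemma ev_level_gen n d (w : seq {i | level_gens n d i}) :
  ev (level_gen n d) (map val w) = \pi_(pres (@level_rel n d)) w.
Proof.
rewrite -pres_genM /ev big_map; apply: eq_bigr => l _.
by rewrite /level_gen valK.
Qed.

(** A value is also given to indices that are not generators of C_t; [piece_side] skips those. *)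
Definition piece_value (c : piece) (l : nat) : factor c :=
  match c return factor c with
  | PDot s => nat_of_bool (l == s) : Algebra.to_multiplicative nat
  | PArc y x => (bicyclic_of (bval x y l),
      Posz (l == x) : Algebra.to_multiplicative int)
  end.

Definition piece_side n (c : piece) (d : diagram) (w : seq nat) : factor c :=
  \prod_(l <- w | level_gens n d l) piece_value c l.

Fixpoint side n (d : diagram) (w : seq nat) : side_monoid d :=
  match d return side_monoid d with
  | [::] => tt
  | c :: d' => (piece_side n c d' w, side n d' w)
  end.

Lemma psi_gen2 n c d l : in_tree n d -> child n d (c :: d) ->
  (@psi_gen n c d l).2 = piece_value c (val l).
Proof.
move=> td; case: c => [s|y x] cd; first by rewrite /=; case: eqP.
have [_ xy _ /(_ (val l))] := child_arc_gens td cd.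
rewrite (valP l) => /esym/andP[_ lxy].
have qE : bicyclic_of (0, 1)%N = bicyclic_q by rewrite /bicyclic_of mul1g expg1.
have pE : bicyclic_of (1, 0)%N = bicyclic_p by rewrite /bicyclic_of mulg1 expg1.
have bp : val l <= x -> bicyclic_of (bval x y (val l)) = bicyclic_p.
  by move=> lx; rewrite -pE /bval lx; congr bicyclic_of; congr pair; lia.
have bq : y <= val l -> bicyclic_of (bval x y (val l)) = bicyclic_q.
  by move=> ly; rewrite -qE /bval ly; congr bicyclic_of; congr pair; lia.
rewrite /= in bp bq lxy *; case: eqVneq => [lx|lx] /=; first by rewrite bp ?lx.
case: eqVneq => [ly|ly] /=; first by rewrite bq ?ly.
by case: ltnP => h; [rewrite bp // ltnW | rewrite bq //; lia].
Qed.

Lemma psi_ev n c d w : in_tree n d -> child n d (c :: d) ->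
  psi c (ev (level_gen n d) w) = (ev (level_gen n (c :: d)) w, piece_side n c d w).
Proof.
move=> td cd; have [[p1 pM] pg] := psi_morph cd.
elim: w => [|l w IH]; first by rewrite /piece_side !ev_nil big_nil p1.
rewrite !ev_cons pM IH /piece_side big_cons.
have [hl|hl] := boolP (level_gens n d l).
  rewrite (level_genE hl) pg; congr pair => /=; first by rewrite psi_gen1.
  by rewrite psi_gen2.
rewrite level_gen_out // p1 mul1g; congr pair.
rewrite [level_gen n (c :: d) l]level_gen_out ?mul1g //.
by apply: contra hl; rewrite (child_gens td cd) => ->.
Qed.

Lemma kappaE n d w : in_tree n d ->
  kappa d (\pi_(pres (@level_rel n [::])) w) =
  (ev (level_gen n d) (map val w), side n d (map val w)).
Proof.
move=> td; elim: {d}td {-2}d (erefl d) => [|d e td IH de] d' ->.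
  by rewrite ev_level_gen.
have [c ec] : exists c, e = c :: d by case: de => *; eexists.
by rewrite ec in de *; rewrite /= (IH _ erefl) /= psi_ev.
Qed.

Lemma eq_count_mem_count (a : pred nat) w w' :
  (forall l, a l -> count_mem l w = count_mem l w') -> count a w = count a w'.
Proof.
move=> e; rewrite -!size_filter; apply: perm_size.
apply/allP => l _ /=; rewrite !count_filter.
have [al|al] := boolP (a l).
  have h s : count (predI (pred1 l) a) s = count_mem l s.
    by apply: eq_count => i /=; case: eqVneq => // ->.
  by rewrite !h e.
have h s : count (predI (pred1 l) a) s = 0%N.
  by rewrite -(count_pred0 s); apply: eq_count => i /=; case: eqVneq => // ->; exact: negPf.
by rewrite !h.
Qed.

Lemma piece_side_dot n s d w : level_gens n d s ->
  piece_side n (PDot s) d w = count_mem s w.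
Proof.
move=> hs; rewrite /piece_side; elim: w => [|l w IH]; first by rewrite big_nil.
rewrite big_cons /= -IH; case: eqVneq => [->|ls]; first by rewrite hs.
by case: ifP => // _; rewrite [LHS]add0n.
Qed.

Lemma piece_side_arc n y x d w : in_tree n d -> child n d (PArc y x :: d) ->
  all (fun l => 0 < l <= n) w ->
  piece_side n (PArc y x) d w =
    (bicyclic_of (bc x y w), Posz (count_mem x w)).
Proof.
move=> td cd; have [x0 xy yn gE] := child_arc_gens td cd.
rewrite /piece_side; elim: w => [|l w IH]; first by rewrite big_nil /bicyclic_of mulg1.
move=> /= /andP[l0 /IH {}IH]; rewrite big_cons gE l0 /= IH; case: ifP => lxy.
  by rewrite bicyclic_ofM; congr pair; rewrite PoszD.
rewrite /bval; have [-> ->] : l <= x = false /\ y <= l = false by lia.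
by rewrite bmul1s; congr (_, Posz _); case: eqVneq => //; lia.
Qed.

(** Comparing unmatched p's suffices: given equal content, the unmatched q's agree too, by
    [content_arcs_bc]. *)
Definition content_arcs (A : seq (nat * nat)) (w w' : seq nat) : Prop :=
  (forall l, count_mem l w = count_mem l w') /\
  (forall a, a \in A -> (bc a.1 a.2 w).1 = (bc a.1 a.2 w').1).

Lemma content_arcs_bc A w w' a : content_arcs A w w' -> a \in A ->
  bc a.1 a.2 w = bc a.1 a.2 w'.
Proof.
move=> [e1 e2] /e2 e; have := bc_diff a.1 a.2 w; have := bc_diff a.1 a.2 w'.
rewrite !(@eq_count_mem_count _ w w') // => h1 h2.
by case: (bc _ _ w) (bc _ _ w') e h1 h2 => [a1 b1] [a2 b2] /= -> *; congr pair; lia.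
Qed.

Lemma side_content n d w w' : in_tree n d ->
    all (fun l => 0 < l <= n) w -> all (fun l => 0 < l <= n) w' ->
  content_arcs (arcs d) w w' -> side n d w = side n d w'.
Proof.
move=> td w0 w0'; elim: {d}td {-2}d (erefl d) => [|d e td IH de] d' ->; first by [].
have [c ec] : exists c, e = c :: d by case: de => *; eexists.
rewrite ec in de * => cA; have [cE aE] := cA; rewrite /=; congr pair; last first.
  by apply: (IH _ erefl); split => // a ad; apply: aE; case: (c) => // *; rewrite inE ad orbT.
case: c {ec} de cA aE => [s|y x] de cA aE.
  by rewrite !piece_side_dot ?cE //; apply: child_dot_gens de.
rewrite !piece_side_arc // cE; congr (bicyclic_of _, _).
by apply: (@content_arcs_bc _ _ _ (x, y) cA); rewrite mem_head.
Qed.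

(** The multiplicities of the used letters are recovered from the last piece back to the first. A
    dot records its own. An arc records that of [x], and that of [y] follows from [bc_diff], the
    other outer letters being known. *)
Lemma content_of_side n d w w' : in_tree n d ->
    all (fun l => 0 < l <= n) w -> all (fun l => 0 < l <= n) w' ->
    (forall l, level_gens n d l -> count_mem l w = count_mem l w') ->
  side n d w = side n d w' -> content_arcs (arcs d) w w'.
Proof.
move=> td w0 w0'; elim: {d}td {-2}d (erefl d) => [|d e td IH de] d' ->.
  move=> h _; split=> // l; case: (boolP (0 < l <= n)) => [/h //|l0].
  have cl s : all (fun l => 0 < l <= n) s -> count_mem l s = 0%N.
    by move=> /allP s0; apply/count_memPn/negP => /s0; apply/negP.
  by rewrite !cl.
have [c ec] : exists c, e = c :: d by case: de => *; eexists.
rewrite ec in de *; move=> cE [e1 e2]; have gE := child_gens td de.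
have {IH e2} : (forall l, l \in piece_indices c -> count_mem l w = count_mem l w') ->
    content_arcs (arcs d) w w'.
  by move=> h; apply: (IH _ erefl _ e2) => l; rewrite gE => /orP[/cE|/h].
case: c {ec} de e1 gE cE => [s|y x] de e1 gE cE IH.
  apply: IH => l; rewrite inE => /eqP ->; have := child_dot_gens td de => hs.
  by rewrite -(piece_side_dot w hs) e1 piece_side_dot.
have [x0 xy yn gE'] := child_arc_gens td de.
move: e1; rewrite !piece_side_arc // => -[/bicyclic_of_inj eb ex].
have cxy l : (0 < l < x) || (y < l <= n) -> count_mem l w = count_mem l w'.
  move=> hl; apply: cE; have := gE l; rewrite gE'.
  by rewrite !inE; case: (level_gens n _ l) => //; lia.
have cy : count (fun l => l <= x) w = count (fun l => l <= x) w'.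
  have h s : all (fun l => 0 < l <= n) s ->
      count (fun l => l <= x) s = count (fun l => 0 < l <= x) s.
    by move=> /allP s0; apply: eq_in_count => l /s0; lia.
  rewrite !h //; apply: eq_count_mem_count => l hl.
  by case: (eqVneq l x) => [->//|lx]; apply: cxy; lia.
have cy' : count (fun l => y <= l) w = count (fun l => y <= l) w'.
  by have := bc_diff x y w; have := bc_diff x y w'; rewrite eb cy; lia.
have {}cy' : count_mem y w = count_mem y w'.
  have h s : all (fun l => 0 < l <= n) s ->
      count (fun l => y <= l) s = (count_mem y s + count (fun l => y < l <= n) s)%N.
    elim: s => //= l s IHs /andP[l0 /IHs ->]; lia.
  move: cy'; rewrite !h // (@eq_count_mem_count (fun l => y < l <= n) w w'); first by lia.
  by move=> l hl; apply: cxy; rewrite hl orbT.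
have [|cA aA] := IH.
  by move=> l; rewrite !inE => /orP[/eqP->|/eqP->].
by split=> // a; rewrite inE => /predU1P[->|/aA //]; rewrite /= eb.
Qed.

(** The arcs are a parameter separate from the interval, so that pairs coming from no vertex of the
    tree are covered as well. *)
Definition outrel n u v A (w w' : seq nat) : Prop :=
  ev (outgen n u v) w = ev (outgen n u v) w' /\ content_arcs A w w'.

Lemma rho_outrel n c d (w w' : seq {i | 0 < i <= n}) : in_tree n (c :: d) ->
  rho n (c :: d) (\pi_(chinese_monoid n) w) (\pi_(chinese_monoid n) w') <->
  outrel n (lo (c :: d)) (hi (c :: d)) (arcs (c :: d)) (map val w) (map val w').
Proof.
move=> td; have w0 (s : seq {i | 0 < i <= n}) : all (fun l => 0 < l <= n) (map val s).
  by apply/allP => l /mapP[i _ ->]; case: i.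
rewrite /rho !(kappaE _ td); split.
  move=> e; have e1 := congr1 fst e; split; first exact: e1.
  apply: (@content_of_side n (c :: d)) (congr1 snd e) => // l hl.
  exact: (@ev_outgen_count n _ _ _ _ e1).
move=> [e1 e2]; congr pair; first exact: e1.
exact: side_content.
Qed.

(** * The triple product in C_{u,v} *)

Lemma subrACA (V : zmodType) (a b c d : V) :
  (a - b - (c - d) = a - c - (b - d))%R.
Proof. by rewrite !opprD addrACA. Qed.

(** The letters [s] are moved to the front one swap at a time. Since [g] need not be multiplicative,
    swaps are assumed in every context, and the induction carries a prefix [a]. *)
Lemma swap_normal_form (C : monoidType) (F : nat -> C) (V : Type) (g : C -> V)
    (B : pred nat) s W :
    ~~ B s -> (forall l, l \in W -> [\/ B l, l = s | F l = 1]) ->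
    (forall a l b, B l -> g (a * (F l * F s) * b) = g (a * (F s * F l) * b)) ->
  g (ev F W) = g (F s ^+ count_mem s W * ev F (filter B W)).
Proof.
move=> Bs Wl gs.
suff h a : g (a * ev F W) = g (a * (F s ^+ count_mem s W * ev F (filter B W))).
  by have := h 1; rewrite !mul1g.
elim: W Wl a => [|l W IH] Wl a; first by rewrite mul1g.
have {}IH b : g (b * ev F W) = g (b * (F s ^+ count_mem s W * ev F (filter B W))).
  by apply: IH => i iW; apply: Wl; rewrite inE iW orbT.
rewrite ev_cons mulgA IH /=.
have [Bl|ls|Fl] := Wl l (mem_head _ _).
- rewrite Bl; have -> : l == s = false by apply: contraNF Bs => /eqP <-.
  rewrite ev_cons add0n; move: (count_mem s W) => k.
  elim: k a => [|k IHk] a; first by rewrite !mul1g !mulgA.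
  have := IHk (a * F s); rewrite expgS !mulgA => <-.
  by have := gs a l (F s ^+ k * ev F (filter B W)); rewrite Bl !mulgA => ->.
- by rewrite ls eqxx (negPf Bs) add1n expgS !mulgA.
rewrite Fl mulg1; case: eqVneq => [ls|ls].
  rewrite -ls in Fl Bs *; rewrite Fl !expg1n (negPf Bs).
  by [].
by case: ifP => // _; rewrite ev_cons Fl mul1g.
Qed.

Section TripleProduct.
Variables (n u v : nat).
(** The empty interval [u = v.+1], from which the descent starts, is allowed; in every case
    [x < y]. *)
Hypotheses (u1 : 1 < u) (vn : v < n) (uv : u <= v.+1).
Let x := u.-1.
Let y := v.+1.
Let F := outgen n u v.
Let valid w := all (fun l => 0 < l <= n) w.

Lemma filter_outgens_outer w : outer_word (outgens n u v) x y (filter (outgens n u v) w).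
Proof.
rewrite /outer_word all_filter; apply/allP => l _; apply/implyP => h.
by rewrite h; move: h; rewrite /outgens /x /y /=; lia.
Qed.

Lemma bc_filter_outgens w : valid w -> bc x y (filter (outgens n u v) w) = bc x y w.
Proof.
elim: w => //= l w IH /andP[l0 /IH {}IH]; case: ifPn; rewrite /= IH // => h.
suff -> : bval x y l = (0, 0)%N by rewrite bmul1s.
by rewrite /bval; congr pair; rewrite /outgens /x /y in h *; lia.
Qed.

Lemma outmon_word (c : outmon n u v) : exists2 w, all (outgens n u v) w & c = ev F w.
Proof.
have e : c = \pi_(pres (@interval_rel (outgens n u v) u v)) (repr c) by rewrite reprK.
exists (map val (repr c)); last by rewrite [LHS]e ev_outgen.
by apply/allP => l /mapP[i _ ->]; case: i.
Qed.

Lemma below_comm l l' : outgens n u v l && (l <= x) ->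
  outgens n u v l' && (l' <= x) -> commute (F l) (F l').
Proof.
have lt_u k : outgens n u v k && (k <= x) -> outgens n u v k && (k < u).
  by rewrite /x => /andP[->] /=; lia.
by move=> /lt_u h /lt_u h'; exact: outgen_low_comm.
Qed.

(** Content, [bc] and the word without [x] and [y] are all compatible with concatenation, so the
    outer factors [b] and [b'] do no harm and [double_commutator_eq] applies. *)
Lemma double_commutator_arc (V : zmodType) (f : outmon n u v -> V) i j b b' W W' :
    outgens n u v i && (i <= x) -> outgens n u v j && (y <= j) ->
    valid W -> valid W' -> outrel n u.-1 v.+1 [:: (x, y)] W W' ->
  double_commutator F x y f i j (b * ev F W * b') =
  double_commutator F x y f i j (b * ev F W' * b').
Proof.
move=> Li Hj vW vW' [e cA].
have [[w wA ->] [w' wA' ->]] := (outmon_word b, outmon_word b').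
rewrite -(ev_outgen_filter n u v W) -(ev_outgen_filter n u v W') -!ev_cat.
have wv s : all (outgens n u v) s -> filter (outgens n u v) s = s.
  by move/all_filterP.
rewrite -{1}(wv _ wA) -{1}(wv _ wA') -{2}(wv _ wA) -{2}(wv _ wA') -!filter_cat.
have cE s l : outgens n u v l -> count_mem l (filter (outgens n u v) s) = count_mem l s.
  by move=> hl; rewrite count_filter; apply: eq_count => k /=; case: eqVneq => // ->.
have gx : outgens n u v x by rewrite /outgens /x; lia.
have gy : outgens n u v y by rewrite /outgens /y; lia.
have sv s : all (outgens n u v) s -> valid s.
  by apply: sub_all => l /andP[].
have vv s : valid s -> valid ((w ++ s) ++ w').
  by move=> vs; rewrite /valid !all_cat -!/(valid _) vs !sv.
apply: (@double_commutator_eq (outgens n u v)) => //.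
- exact: outgen_chinese.
- by rewrite /x /y; lia.
- exact: below_comm.
- by move=> l l' h h'; exact: outgen_high_comm.
- exact: filter_outgens_outer.
- exact: filter_outgens_outer.
- by rewrite !cE // !count_cat cA.1.
- by rewrite !cE // !count_cat cA.1.
- rewrite !bc_filter_outgens ?bc_cat; first last.
  + exact: vv.
  + exact: vv.
  by rewrite (content_arcs_bc cA (mem_head _ _)).
have fE s : filter (predI (predC1 x) (predC1 y)) (filter (outgens n u v) s) =
    filter (outgens n u.-1 v.+1) s.
  rewrite -filter_predI; apply: eq_filter => l /=.
  by rewrite /outgens /x /y; lia.
rewrite !fE !filter_cat !ev_cat; congr (_ * _ * _).
apply: (@ev_outgen_sub n u v u.-1 v.+1); rewrite ?filter_all ?ev_outgen_filter //; lia.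
Qed.

(** The eight terms expand [f] on (W1 - W1')(W2 - W2')(W3 - W3'). Each dot relation is reduced to
    swaps of [y] in the third factor or of [x] in the first, and [double_commutator_arc] handles a
    swap on both sides at once. *)
Lemma triple_product (V : zmodType) (f : outmon n u v -> V) W1 W1' W2 W2' W3 W3' :
    valid W1 -> valid W1' -> valid W2 -> valid W2' -> valid W3 -> valid W3' ->
    outrel n u.-1 v [::] W1 W1' -> outrel n u.-1 v.+1 [:: (u.-1, v.+1)] W2 W2' ->
    outrel n u v.+1 [::] W3 W3' ->
  let g a b c := f (ev F (a ++ b ++ c)) in
  let g' b c := (g W1 b c - g W1' b c)%R in
  (g' W2 W3 - g' W2' W3 - (g' W2 W3' - g' W2' W3') = 0)%R.
Proof.
move=> vW1 vW1' vW2 vW2' vW3 vW3' [e1 c1] r2 [e3 c3] g g'.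
pose H a c := (f (a * ev F W2 * c)%g - f (a * ev F W2' * c)%g)%R.
have core a j b c i d : outgens n u v j && (y <= j) -> outgens n u v i && (i <= x) ->
    ((H (a * (F x * F j) * b)%g (c * (F i * F y) * d)%g -
      H (a * (F j * F x) * b)%g (c * (F i * F y) * d)%g) -
     (H (a * (F x * F j) * b)%g (c * (F y * F i) * d)%g -
      H (a * (F j * F x) * b)%g (c * (F y * F i) * d)%g) = 0)%R.
  move=> Hj Li.
  have /eqP := double_commutator_arc (fun z => f (a * z * d)) b c Li Hj vW2 vW2' r2.
  rewrite -subr_eq0 /double_commutator /H !mulgA => /eqP <-.
  by rewrite [RHS]subrACA; congr (_ - _)%R; exact: subrACA.
pose K a a' c := (H a c - H a' c)%R.
have letters w (B : pred nat) s : valid w ->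
    (forall l, outgens n u v l = B l || (l == s)) ->
    forall l, l \in w -> [\/ B l, l = s | F l = 1].
  move=> /allP vw Bs l /vw vl; case: (boolP (outgens n u v l)).
    by rewrite Bs => /orP[|/eqP]; [exact: Or31 | exact: Or32].
  by move=> /outgen_out; exact: Or33.
have gx l : outgens n u v l = outgens n u.-1 v l || (l == x).
  by rewrite /outgens /x; lia.
have gy l : outgens n u v l = outgens n u v.+1 l || (l == y).
  by rewrite /outgens /y; lia.
(* With [x,j] fixed on the left, [y] moves to the front of [W3]: past low letters by [core], past
   high ones because they commute. The remaining words agree already in C_{u,v+1}. *)
have swap3 a j b : outgens n u v j && (y <= j) ->
    let k := K (a * (F x * F j) * b) (a * (F j * F x) * b) in
    k (ev F W3) = k (ev F W3').
  move=> Hj k.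
  have ky c l d : outgens n u v.+1 l -> k (c * (F l * F y) * d) = k (c * (F y * F l) * d).
    move=> hl; have [lx|xl] := leqP l x.
      apply/eqP; rewrite -subr_eq0; apply/eqP/core => //.
      by rewrite gy hl.
    congr (k (c * _ * d)); apply: outgen_high_comm.
      by rewrite gy hl; rewrite /outgens in hl; lia.
    by rewrite gy eqxx orbT /y leqnn.
  have nB : ~~ outgens n u v.+1 y by rewrite /outgens /y; lia.
  rewrite (swap_normal_form nB (letters _ _ _ vW3 gy) ky).
  rewrite (swap_normal_form nB (letters _ _ _ vW3' gy) ky) c3.1.
  congr (k (_ * _)); apply: (@ev_outgen_sub n u v u v.+1);
    rewrite ?filter_all ?ev_outgen_filter //; lia.
(* The same is now done with [x] in the first factor, [swap3] giving its swaps with high letters. *)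
pose G a := (H a (ev F W3) - H a (ev F W3'))%R.
have Gx a l b : outgens n u.-1 v l -> G (a * (F l * F x) * b) = G (a * (F x * F l) * b).
  move=> hl; have [lx|xl] := leqP y l.
    apply/eqP; rewrite eq_sym -subr_eq0 /G subrACA.
    by rewrite -/(K _ _ _) swap3 ?subrr // gx hl.
  congr (G (a * _ * b)); apply: outgen_low_comm.
    by rewrite gx hl; rewrite /outgens in hl; lia.
  by rewrite gx eqxx orbT /x; lia.
have nB : ~~ outgens n u.-1 v x by rewrite /outgens /x; lia.
have GE : G (ev F W1) = G (ev F W1').
  rewrite (swap_normal_form nB (letters _ _ _ vW1 gx) Gx).
  rewrite (swap_normal_form nB (letters _ _ _ vW1' gx) Gx) c1.1.
  congr (G (_ * _)); apply: (@ev_outgen_sub n u v u.-1 v);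
    rewrite ?filter_all ?ev_outgen_filter //; lia.
have gE a b c : g a b c = f (ev F a * ev F b * ev F c).
  by rewrite /g !ev_cat mulgA.
rewrite /g' !gE [X in (X - _)%R]subrACA [X in (_ - X)%R]subrACA.
rewrite -/(H _ _) -/(H _ _) -/(H _ _) -/(H _ _) subrACA -/(G _) -/(G _).
by rewrite GE subrr.
Qed.

End TripleProduct.

(** * Prime ideals and the first level *)

Local Open Scope ring_scope.

Lemma malgU_mul (K : nzRingType) (M : monomType) (s t : M) :
  << s >> * << t >> = << monalg.mmul s t >> :> {malg K[M]}.
Proof. by rewrite malgM_def fgmulUU mulr1. Qed.

Lemma malgUZ (K : nzRingType) (M : monomType) (c : K) (s : M) :
  << c *g s >> = c *: << s >> :> {malg K[M]}.
Proof.
apply/malgP => k; rewrite mcoeffZ !mcoeffU.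
by case: eqP => _; rewrite ?mulr1n ?mulr0n ?mulr0 ?mulr1.
Qed.

Lemma malg_scaleAr (K : fieldType) (M : monomType) (c : K) (a b : {malg K[M]}) :
  a * (c *: b) = c *: (a * b).
Proof.
have ac : a * c%:MP = c%:MP * a.
  rewrite (monalgE a) mulr_sumr mulr_suml; apply: eq_bigr => k _.
  by rewrite !malgM_def !fgmulUU mulrC mul1m mulm1.
by rewrite -!mul_malgC mulrA ac mulrA.
Qed.

Section TwoSided.
Variables (K : fieldType) (M : monomType) (P : set {malg K[M]}).
Hypothesis iP : two_sided_ideal P.

Lemma two_sided0 : P 0. Proof. by case: iP. Qed.
Lemma two_sidedD a b : P a -> P b -> P (a + b). Proof. by case: iP => _ h _; apply: h. Qed.
Lemma two_sidedMl r a : P a -> P (r * a). Proof. by case: iP => _ _ h /(h r)[]. Qed.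
Lemma two_sidedMr r a : P a -> P (a * r). Proof. by case: iP => _ _ h /(h r)[]. Qed.
Lemma two_sidedN a : P a -> P (- a). Proof. by move=> h; rewrite -mulN1r; apply: two_sidedMl. Qed.
Lemma two_sidedB a b : P a -> P b -> P (a - b).
Proof. by move=> ha hb; apply: two_sidedD => //; apply: two_sidedN. Qed.
Lemma two_sidedZ (c : K) a : P a -> P (c *: a).
Proof. by move=> h; rewrite -mul_malgC; apply: two_sidedMl. Qed.

Lemma two_sided_sum (I : Type) (r : seq I) (F : I -> {malg K[M]}) :
  (forall i, P (F i)) -> P (\sum_(i <- r) F i).
Proof.
move=> h; elim: r => [|i r IH]; rewrite ?big_nil ?big_cons.
  exact: two_sided0.
exact: two_sidedD.
Qed.

(** Each of the eight products may be replaced by a term congruent to it modulo [P]. *)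
Lemma two_sided_alt_sum p1 p2 p3 p4 p5 p6 p7 p8 q1 q2 q3 q4 q5 q6 q7 q8 :
    P (p1 - q1) -> P (p2 - q2) -> P (p3 - q3) -> P (p4 - q4) ->
    P (p5 - q5) -> P (p6 - q6) -> P (p7 - q7) -> P (p8 - q8) ->
    q1 - q2 - (q3 - q4) - (q5 - q6 - (q7 - q8)) = 0 ->
  P (p1 - p2 - (p3 - p4) - (p5 - p6 - (p7 - p8))).
Proof.
move=> h1 h2 h3 h4 h5 h6 h7 h8 e.
have h12 := two_sidedB h1 h2; have h34 := two_sidedB h3 h4.
have h56 := two_sidedB h5 h6; have h78 := two_sidedB h7 h8.
have := two_sidedB (two_sidedB h12 h34) (two_sidedB h56 h78).
rewrite (subrACA p1 q1) (subrACA p3 q3) (subrACA p5 q5) (subrACA p7 q7).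
rewrite (subrACA (p1 - p2)) (subrACA (p5 - p6)) (subrACA (p1 - p2 - (p3 - p4))).
by rewrite e subr0.
Qed.

End TwoSided.

Lemma mul_triple_sub (R : nzRingType) (a a' b b' c c' : R) :
  (a - a') * (b - b') * (c - c') =
  a * b * c - a' * b * c - (a * b' * c - a' * b' * c) -
  (a * b * c' - a' * b * c' - (a * b' * c' - a' * b' * c')).
Proof. by rewrite !mulrBr !mulrBl. Qed.

Lemma mul_sub_sub_eq0 (R : nzRingType) (a a' b c c' : R) :
  (a * b * c = a' * b * c /\ a * b * c' = a' * b * c') \/
  (a * b * c = a * b * c' /\ a' * b * c = a' * b * c') ->
  (a - a') * b * (c - c') = 0.
Proof.
by rewrite mulrBr !mulrBl => -[[-> ->]|[-> ->]]; rewrite !subrr.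
Qed.

Section Prime.
Variables (K : fieldType) (M : monomType) (P : set {malg K[M]}).
Hypothesis hP : prime_two_sided_ideal P.
Let iP : two_sided_ideal P. Proof. by case: hP. Qed.

(** Elementwise primality. Taking [I] as all c with c R b inside [P], and [J] as all e with I R e
    inside [P], gives two-sided ideals containing [a] and [b] without forming generated ideals. *)
Lemma prime_mulP a b : (forall r : M, P (a * << r >> * b)) -> P a \/ P b.
Proof.
move=> ab; have {}ab r : P (a * r * b).
  rewrite (monalgE r) mulr_sumr mulr_suml; apply: (two_sided_sum iP) => k.
  rewrite malgUZ (malg_scaleAr (r@_k) a << k >>).
  have <- : r@_k *: (a * << k >> * b) = r@_k *: (a * << k >>) * b.
    exact: scalerAl.
  exact: (two_sidedZ iP).
pose I := [set c | forall r, P (c * r * b)].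
pose J := [set e | forall c, I c -> forall r, P (c * r * e)].
have iI : two_sided_ideal I.
  split=> [r|c c' hc hc' r|r c hc]; first by rewrite !mul0r; apply: two_sided0.
    by rewrite !mulrDl; apply: two_sidedD.
  split=> s; first by rewrite -!mulrA; apply: two_sidedMl => //; rewrite mulrA.
  by rewrite -(mulrA c); apply: hc.
have iJ : two_sided_ideal J.
  split=> [c _ r|e e' he he' c hc r|r e he]; first by rewrite mulr0; apply: two_sided0.
    by rewrite mulrDr; apply: (two_sidedD iP); [apply: he | apply: he'].
  split=> c hc s; first by rewrite mulrA -(mulrA c); apply: he.
  by rewrite mulrA; apply: two_sidedMr => //; apply: he.
case: hP => _ _ /(_ I J iI iJ) [].
- by move=> c e hc /(_ c hc 1); rewrite mulr1.
- by move=> IP; left; apply: IP.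
- by move=> JP; right; apply: JP => c hc r; apply: hc.
Qed.

End Prime.

(** * Congruence ideals inside a prime and the enlargement of the interval *)

Section Containment.
Variables (K : fieldType) (n : nat).
Local Notation M := (chinese_monoid n).

Definition mword (w : seq nat) : M := ev (level_gen n [::]) w.

Definition wmon (w : seq nat) : {malg K[M]} := << mword w >>.

Definition valid_word (w : seq nat) := all (fun l => 0 < l <= n)%N w.

Lemma wmon_cat w w' : wmon (w ++ w') = wmon w * wmon w'.
Proof. by rewrite /wmon malgU_mul /mword ev_cat. Qed.

Lemma mword_pi (w : seq {i | (0 < i <= n)%N}) : mword (map val w) = \pi_M w.
Proof. exact: (@ev_level_gen n [::]). Qed.

Lemma mword_surj (s : M) : exists2 w, valid_word w & s = mword w.
Proof.
exists (map val (repr s)); last by rewrite mword_pi reprK.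
by apply/allP => l /mapP[i _ ->]; case: i.
Qed.

Lemma valid_word_lift w : valid_word w ->
  exists w' : seq {i | (0 < i <= n)%N}, w = map val w'.
Proof.
elim: w => [|l w IH] /=; first by exists [::].
by case/andP=> hl /IH[w' ->]; exists (exist _ l hl :: w').
Qed.

Lemma valid_word_cat w w' : valid_word (w ++ w') = valid_word w && valid_word w'.
Proof. exact: all_cat. Qed.

Definition contains (P : set {malg K[M]}) u v A := forall w w',
  valid_word w -> valid_word w' -> outrel n u v A w w' -> P (wmon w - wmon w').

Lemma contains_congruence_ideal P c d : two_sided_ideal P -> in_tree n (c :: d) ->
  contains P (lo (c :: d)) (hi (c :: d)) (arcs (c :: d)) ->
  congruence_ideal K (rho n (c :: d)) `<=` P.
Proof.
move=> iP td cP f [r [rr ->]].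
have: forall z, z \in r -> P (z.1 *: (<< z.2.1 >> - << z.2.2 >>)).
  move=> [k [s t]] /rr /=; have [[w vw ->] [w' vw' ->]] := (mword_surj s, mword_surj t).
  move=> h; apply: two_sidedZ => //; apply: cP => //.
  have [[x ex] [x' ex']] := (valid_word_lift vw, valid_word_lift vw').
  by move: h; rewrite ex ex' !mword_pi => /(rho_outrel x x' td).
elim: (r) => [|z r' IH] h; first by rewrite big_nil; apply: two_sided0.
rewrite big_cons; apply: two_sidedD => //; first by apply: h; rewrite mem_head.
by apply: IH => i ir; apply: h; rewrite inE ir orbT.
Qed.

Lemma content_arcs_refl A w : content_arcs A w w. Proof. by []. Qed.

Lemma content_arcs_sym A w w' : content_arcs A w w' -> content_arcs A w' w.
Proof. by move=> [e1 e2]; split=> [l|a aA]; rewrite ?e1 ?e2. Qed.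

Lemma content_arcs_trans A w1 w2 w3 : content_arcs A w1 w2 ->
  content_arcs A w2 w3 -> content_arcs A w1 w3.
Proof.
by move=> [e1 e2] [f1 f2]; split=> [l|a aA]; rewrite ?e1 ?f1 ?e2 ?f2.
Qed.

Lemma content_arcs_cat A w1 w1' w2 w2' : content_arcs A w1 w1' ->
  content_arcs A w2 w2' -> content_arcs A (w1 ++ w2) (w1' ++ w2').
Proof.
move=> c1 c2; split=> [l|a aA]; first by rewrite !count_cat c1.1 c2.1.
by rewrite !bc_cat (content_arcs_bc c1 aA) (content_arcs_bc c2 aA).
Qed.

Lemma content_arcs_sub (A B : seq (nat * nat)) w w' : {subset A <= B} ->
  content_arcs B w w' -> content_arcs A w w'.
Proof. by move=> AB [e1 e2]; split=> // a /AB /e2. Qed.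

Lemma outrel_cat u v A w1 w1' w2 w2' : outrel n u v A w1 w1' ->
  outrel n u v A w2 w2' -> outrel n u v A (w1 ++ w2) (w1' ++ w2').
Proof.
move=> [e1 c1] [e2 c2]; split; last exact: content_arcs_cat.
by rewrite !ev_cat e1 e2.
Qed.

Lemma not_contains P u v A : ~ contains P u v A -> exists w w',
  [/\ valid_word w, valid_word w', outrel n u v A w w' & ~ P (wmon w - wmon w')].
Proof.
move=> h; apply: contrapT => h'; apply: h => w w' vw vw' r.
by apply: contrapT => h; apply: h'; exists w, w'.
Qed.

(** If all three failed, there would be differences [a], [b], [c] outside [P] with a r b s c in [P]
    for all r, s, against primality. The product vanishes in C_{u,v} by [triple_product], and [cP]
    transports this to [P]. *)
Lemma contains_step P u v A : prime_two_sided_ideal P ->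
    (1 < u)%N -> (v < n)%N -> (u <= v.+1)%N -> contains P u v A ->
  [\/ contains P u.-1 v A,
      contains P u.-1 v.+1 ((u.-1, v.+1) :: A) | contains P u v.+1 A].
Proof.
move=> hP u1 vn uv cP; have iP : two_sided_ideal P by case: hP.
apply: contrapT => nc.
have /not_contains[W1 [W1' [v1 v1' r1 n1]]] : ~ contains P u.-1 v A.
  by move=> h; apply: nc; exact: Or31.
have /not_contains[W2 [W2' [v2 v2' r2 n2]]] : ~ contains P u.-1 v.+1 ((u.-1, v.+1) :: A).
  by move=> h; apply: nc; exact: Or32.
have /not_contains[W3 [W3' [v3 v3' r3 n3]]] : ~ contains P u v.+1 A.
  by move=> h; apply: nc; exact: Or33.
pose a := wmon W1 - wmon W1'; pose b := wmon W2 - wmon W2'.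
pose c := wmon W3 - wmon W3'.
suff abc r s : P (a * << r >> * b * << s >> * c).
  have [r|/n1 //|/n2 //] := @prime_mulP _ _ _ hP a b.
  have [s|//|/n3 //] := @prime_mulP _ _ _ hP (a * << r >> * b) c.
  exact: abc.
have [[R vR ->] [S vS ->]] := (mword_surj r, mword_surj s).
(* The elements r and s are absorbed into the middle factor, [outrel] being compatible with
   products. *)
pose V2 := R ++ W2 ++ S; pose V2' := R ++ W2' ++ S.
have vV2 : valid_word V2 by rewrite !valid_word_cat vR v2.
have vV2' : valid_word V2' by rewrite !valid_word_cat vR v2'.
have -> : a * << mword R >> * b * << mword S >> * c = a * (wmon V2 - wmon V2') * c.
  by rewrite !wmon_cat -mulrBr -mulrBl !mulrA.
have rV2 : outrel n u.-1 v.+1 ((u.-1, v.+1) :: A) V2 V2'.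
  by do 2![apply: outrel_cat => //].
move: V2 V2' vV2 vV2' rV2 => {n2 r2 v2 v2' b} V2 V2' v2 v2' r2 {nc}.
have s1 : content_arcs A W1 W1' by case: r1.
have s2 : content_arcs A V2 V2'.
  by case: r2 => _; apply: content_arcs_sub => i; rewrite inE => ->; rewrite orbT.
have s3 : content_arcs A W3 W3' by case: r3.
have {}r1 : outrel n u.-1 v [::] W1 W1' by case: r1 => ? [].
have {}r2 : outrel n u.-1 v.+1 [:: (u.-1, v.+1)] V2 V2'.
  case: r2 => ? [? h]; split=> //; split=> // i; rewrite inE => /eqP ->.
  by apply: h; rewrite mem_head.
have {}r3 : outrel n u v.+1 [::] W3 W3' by case: r3 => ? [].
pose W0 := W1 ++ V2 ++ W3.
(* All eight products share the content and arc data of [W0]. So [f] can choose, over [z], a word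
   with exactly these data, and by [cP] it represents each product modulo [P]; the default [[::]] is
   not taken there. *)
pose f (z : outmon n u v) := wmon (xget [::] [set W | [/\ valid_word W,
  ev (outgen n u v) W = z & content_arcs A W W0]]).
have fE W : valid_word W -> content_arcs A W W0 ->
    P (wmon W - f (ev (outgen n u v) W)).
  move=> vW cW; rewrite /f; case: xgetP => [W' -> [vW' eW' cW']|/(_ W)].
    apply: cP => //; split=> //; apply: content_arcs_trans cW _.
    exact: content_arcs_sym.
  by case; split.
have fE3 X1 X2 X3 : valid_word X1 -> valid_word X2 -> valid_word X3 ->
    content_arcs A X1 W1 -> content_arcs A X2 V2 -> content_arcs A X3 W3 ->
    P (wmon X1 * wmon X2 * wmon X3 - f (ev (outgen n u v) (X1 ++ X2 ++ X3))).
  move=> x1 x2 x3 d1 d2 d3; rewrite -mulrA -!wmon_cat; apply: fE.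
    by rewrite !valid_word_cat x1 x2.
  by do 2![apply: content_arcs_cat => //].
have := triple_product u1 vn uv f v1 v1' v2 v2' v3 v3' r1 r2 r3.
have s1' := content_arcs_sym s1; have s2' := content_arcs_sym s2.
have s3' := content_arcs_sym s3; have sr := content_arcs_refl.
move=> /= E.
rewrite /a /c mul_triple_sub; apply: (two_sided_alt_sum iP _ _ _ _ _ _ _ _ E);
  by apply: fE3.
Qed.

(** By [commutator_product] and primality, for each [s] the letters up to [s] or those from [s] on
    commute modulo [P]. The first holds trivially at 1 and the second at [n], so somewhere a cut has
    both sides commuting. *)
Lemma contains_commuting P : prime_two_sided_ideal P -> (1 < n)%N ->
  exists2 s, (0 < s < n)%N & contains P s.+1 s [::].
Proof.
move=> hP n1; have iP : two_sided_ideal P by case: hP.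
pose comm i k := P (wmon [:: i; k] - wmon [:: k; i]).
pose good i := (0 < i <= n)%N.
pose L s := forall i k, good i -> good k -> (i <= s)%N -> (k <= s)%N -> comm i k.
pose H s := forall i k, good i -> good k -> (s <= i)%N -> (s <= k)%N -> comm i k.
have chin : chinese_family good (level_gen n [::]).
  move=> i k j gi gk gj ikj.
  pose xi : {i | level_gens n [::] i} := exist _ i gi.
  pose xk : {i | level_gens n [::] i} := exist _ k gk.
  pose xj : {i | level_gens n [::] i} := exist _ j gj.
  have e a b c : (level_gen n [::] (val a) * (level_gen n [::] (val b) *
      level_gen n [::] (val c)) = \pi_(pres (@level_rel n [::])) [:: a; b; c])%g.
    by rewrite -(ev_level_gen [:: a; b; c]) /= !ev_cons ev_nil mulg1.
  split; [rewrite (e xj xi xk) (e xj xk xi)|rewrite (e xj xk xi) (e xk xj xi)];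
    apply/pres_eqP/pres_rel0; [exact: chinese_jik | exact: chinese_jki].
have LH s : L s \/ H s.
  apply: contrapT => nLH.
  have [i [k [gi gk is_ ks nik]]] : exists i k,
      [/\ good i, good k, (i <= s)%N, (k <= s)%N & ~ comm i k].
    apply: contrapT => h; apply: nLH; left=> i k gi gk is_ ks.
    by apply: contrapT => h'; apply: h; exists i, k.
  have [j [l [gj gl sj sl njl]]] : exists j l,
      [/\ good j, good l, (s <= j)%N, (s <= l)%N & ~ comm j l].
    apply: contrapT => h; apply: nLH; right=> j l gj gl sj sl.
    by apply: contrapT => h'; apply: h; exists j, l.
  have [r|/njl[]|/nik[]] := @prime_mulP _ _ _ hP (wmon [:: j; l] - wmon [:: l; j])
    (wmon [:: i; k] - wmon [:: k; i]).
  have [w vw ->] := mword_surj r; rewrite -/(wmon w).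
  have e w1 w1' w2 w2' : (ev (level_gen n [::]) w1 *
        (ev (level_gen n [::]) w * ev (level_gen n [::]) w2) =
      ev (level_gen n [::]) w1' *
        (ev (level_gen n [::]) w * ev (level_gen n [::]) w2'))%g ->
      wmon w1 * wmon w * wmon w2 = wmon w1' * wmon w * wmon w2'.
    have pe v v' : wmon v * wmon w * wmon v' = wmon (v ++ w ++ v').
      by rewrite (wmon_cat v) (wmon_cat w) mulrA.
    have me v v' : mword (v ++ w ++ v') = (ev (level_gen n [::]) v *
        (ev (level_gen n [::]) w * ev (level_gen n [::]) v'))%g.
      by rewrite /mword !ev_cat.
    move=> h; have mE : mword (w1 ++ w ++ w2) = mword (w1' ++ w ++ w2').
      by rewrite (me w1) h (me w1').
    apply: etrans (pe w1 w2) _; apply: etrans (esym (pe w1' w2')).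
    exact: (congr1 (fun m => << m >>) mE).
  have ev2 a b : (level_gen n [::] a * level_gen n [::] b)%g =
      ev (level_gen n [::]) [:: a; b] by rewrite !ev_cons ev_nil mulg1.
  suff h0 : (wmon [:: j; l] - wmon [:: l; j]) * wmon w *
      (wmon [:: i; k] - wmon [:: k; i]) = 0 by rewrite h0; exact: two_sided0.
  apply: mul_sub_sub_eq0.
  have := commutator_product chin gi gk gj gl is_ ks sj sl vw.
  rewrite /= !ev2 => -[h|h]; [left | right].
    by split; apply: e; apply: h; [left | right].
  by split; apply: e; apply: h; [left | right].
have [s [s0 sn Ls Hs]] : exists s, [/\ (0 < s)%N, (s < n)%N, L s & H s.+1].
  have comm1 i k : i = k -> comm i k.
    by move=> ->; rewrite /comm subrr; apply: two_sided0.
  have L1 : L 1%N by move=> i k; rewrite /good => *; apply: comm1; lia.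
  have Hn : H n by move=> i k; rewrite /good => *; apply: comm1; lia.
  (* If [L] passes from [m.+1] to [m.+2] the walk continues; otherwise [H m.+2] holds and the cut is
     at [m.+1]. *)
  suff h m : (0 < m <= n)%N -> L m \/ exists s, [/\ (0 < s)%N, (s < m)%N, L s & H s.+1].
    have [|Ln|[s [s0 sn Ls Hs]]] := h n.-1; first by lia.
      have en : n.-1.+1 = n by lia.
      by exists n.-1; rewrite en; split=> //; lia.
    by exists s; split=> //; lia.
  elim: m => // m IH hm; case: m IH hm => [|m] IH hm; first by left.
  have [|Lm|[s [s0 sm Ls Hs]]] := IH; first by lia.
    by have [h|h] := LH m.+2; [left | right; exists m.+1; split].
  by right; exists s; split=> //; lia.
exists s; first by rewrite s0.
move=> w w' vw vw' [e _].
have wmon_out (x : seq nat) : valid_word x -> all (outgens n s.+1 s) x.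
  by apply: sub_all => l; rewrite /outgens; lia.
have [[x ex] [x' ex']] := (outgens_lift (wmon_out _ vw), outgens_lift (wmon_out _ vw')).
move: e; rewrite ex ex' !ev_outgen => /pres_eqP.
elim=> [a b c d cd|z|z z' _|z1 z2 z3 _ h1 _ h2]; first last.
- by have := two_sidedD iP h1 h2; rewrite addrA subrK.
- by move=> h; rewrite -opprB; apply: two_sidedN.
- by rewrite subrr; apply: two_sided0.
rewrite !map_cat !wmon_cat -mulrBr -mulrBl.
apply: (two_sidedMl iP); apply: (two_sidedMr iP).
have gv (z : {i | outgens n s.+1 s i}) : good (val z).
  by case: z => z /=; rewrite /outgens => /andP[].
case: cd => [_ _ [i k j|i k j] ikj|i j is_ js|i j is_ js] /=.
- suff -> : wmon [:: val j; val i; val k] = wmon [:: val j; val k; val i].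
    by rewrite subrr; apply: two_sided0.
  rewrite /wmon /mword !ev_cons ev_nil !mulg1.
  by have [-> _] := chin _ _ _ (gv i) (gv k) (gv j) ikj.
- suff -> : wmon [:: val j; val k; val i] = wmon [:: val k; val j; val i].
    by rewrite subrr; apply: two_sided0.
  rewrite /wmon /mword !ev_cons ev_nil !mulg1.
  by have [_ ->] := chin _ _ _ (gv i) (gv k) (gv j) ikj.
- exact: (Ls _ _ (gv i) (gv j) is_ js).
- exact: (Hs _ _ (gv i) (gv j) is_ js).
Qed.

End Containment.

Local Close Scope ring_scope.

(** * Descent to a leaf *)

Lemma ev_perm (C : monoidType) (F : nat -> C) w w' :
  (forall l l', commute (F l) (F l')) -> perm_eq w w' -> ev F w = ev F w'.
Proof.
move=> FC; elim: w w' => [|l w IH] w' ww'.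
  by move: ww'; rewrite perm_sym => /perm_nilP ->.
have lw' : l \in w' by rewrite -(perm_mem ww') mem_head.
case/splitPr: w' / lw' ww' => w1 w2.
rewrite perm_sym -(cat1s l w2) perm_catCA /= perm_cons perm_sym => /IH.
rewrite ev_cons => ->; rewrite !ev_cat ev_cons !mulgA; congr (_ * _).
elim: w1 => [|k w1 IHw]; first by rewrite ev_nil mul1g mulg1.
by rewrite ev_cons mulgA FC -mulgA IHw mulgA.
Qed.

(** All remaining letters lie on one side, so C_{u,v} is commutative and the content decides. *)
Lemma outrel_one_sided n u v A w w' : u <= 1 \/ n <= v ->
  content_arcs A w w' -> outrel n u v A w w'.
Proof.
move=> uv cA; split=> //; apply: ev_perm; last first.
  by apply/allP => l _; apply/eqP/cA.1.
move=> l l'.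
have [hl|/outgen_out->] := boolP (outgens n u v l); last exact/commute_sym/commute1.
have [hl'|/outgen_out->] := boolP (outgens n u v l'); last exact: commute1.
case: uv => h; [apply: outgen_high_comm | apply: outgen_low_comm];
  by rewrite /outgens in hl hl' *; lia.
Qed.

Section Descent.
Variables (K : fieldType) (n : nat) (P : set {malg K[chinese_monoid n]}).
Hypothesis hP : prime_two_sided_ideal P.

Lemma contains_sub u v A u' v' A' :
  (forall w w', outrel n u v A w w' -> outrel n u' v' A' w w') ->
  contains P u' v' A' -> contains P u v A.
Proof. by move=> h c w w' vw vw' /h; apply: c. Qed.

(** The vertex [e] need not be a child of [d]. If the required dot child is missing, a vertex with
    the same enlarged interval and at least the arcs of [d] has a finer relation. *)
Lemma contains_next d : in_tree n d -> d <> [::] -> ~~ has_end_arc n d ->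
    contains P (lo d) (hi d) (arcs d) ->
  exists e, [/\ in_tree n e, e <> [::], hi d - lo d < hi e - lo e
    & contains P (lo e) (hi e) (arcs e)].
Proof.
move=> td d0 hd cd; have lh := lo_le_hi d.
have [l1 h1 /(_ hd)[l2 h2]] := in_tree_bounds td d0.
pose arc := PArc (hi d + 1) (lo d - 1) :: d.
have arcE : lo arc = (lo d).-1 /\ hi arc = (hi d).+1.
  by rewrite /arc lo_cons // hi_consE /=; lia.
have use_arc : contains P (lo d).-1 (hi d).+1 (((lo d).-1, (hi d).+1) :: arcs d) ->
    exists e, [/\ in_tree n e, e <> [::], hi d - lo d < hi e - lo e
      & contains P (lo e) (hi e) (arcs e)].
  move=> h; exists arc; rewrite arcE.1 arcE.2; split=> //.
  - by apply: in_tree_child td _; exact: child_arc.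
  - lia.
  by rewrite /arcs /= -/(arcs d) addn1 subn1.
have [c [d' dE]] : exists c d', d = c :: d' by case: (d) d0 => // c d' _; exists c, d'.
have dotE s d2 : d = PDot s :: d2 -> [\/ d2 = [::] /\ lo d = hi d /\ s = lo d,
    [/\ d2 <> [::], s = hi d & lo d = lo d2 /\ hi d = (hi d2).+1] |
    [/\ d2 <> [::], s = lo d & lo d = (lo d2).-1 /\ hi d = hi d2]].
  move=> e; move: td; rewrite e => td2; inversion td2 as [|d3 e3 td3 ch e4]; subst e3.
  have d3E : d3 = d2 by inversion ch.
  subst d3; have [d20|d20] : d2 = [::] \/ d2 <> [::] by case: (d2); [left | right].
    by rewrite d20 lo_dot1 hi_dot1; apply: Or31.
  have [b1 b2 b3] := in_tree_bounds td3 d20; have b4 := lo_le_hi d2.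
  rewrite lo_cons // hi_consE /=.
  have [_ [<-] [/b3[b5 b6]]] := child_cases ch d20.
  by case=> // -[[->] ?]; [apply: Or32 | apply: Or33]; split=> //; lia.
have td' : d' <> [::] -> in_tree n d' /\ ~~ has_end_arc n d'.
  move=> d'0; move: td; rewrite dE => td2; inversion td2 as [|d3 e3 td3 ch e4]; subst e3.
  have d3E : d3 = d' by inversion ch.
  subst d3; split=> //; apply: contra hd; rewrite dE => h.
  by rewrite /has_end_arc /= -/(has_end_arc n d') h orbT.
have [cx|ca|cy] := contains_step hP l2 h2 (leq_trans lh (leqnSn _)) cd; last first.
(* At the upper end of the range no letter remains above, so the arc child has the finer
   relation. *)
- have [yn|yn] := leqP n (hi d).+1.
    apply: use_arc; apply: contains_sub cy => w w' [_ cA].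
    apply: outrel_one_sided; first by right.
    by apply: content_arcs_sub cA => a ad; rewrite inE ad orbT.
  have use_dot : child n d (PDot (hi d + 1) :: d) -> exists e, [/\ in_tree n e,
      e <> [::], hi d - lo d < hi e - lo e & contains P (lo e) (hi e) (arcs e)].
    move=> ch; exists (PDot (hi d + 1) :: d); split=> //.
    + exact: in_tree_child td ch.
    + by rewrite lo_cons // hi_consE /=; lia.
    suff [-> ->] : lo (PDot (hi d + 1) :: d) = lo d /\
      hi (PDot (hi d + 1) :: d) = (hi d).+1 by [].
    by rewrite lo_cons // hi_consE /=; lia.
  case: c dE => [s|y x] dE; last by apply: use_dot; apply: child_arc_hi dE _ _; lia.
  have arcsE : arcs d = arcs d' by rewrite dE.
  case: (dotE _ _ dE) => [[d'0 [el es]]|[d'0 es [el eh]]|[d'0 es [el eh]]].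
  (* A single dot has no dot child; the level 1 arc on the same two indices replaces it. *)
  + exists [:: PArc s.+1 s]; rewrite lo_arc1 hi_arc1; split=> //.
    * apply: in_tree_child (in_tree_root n) _.
      by have := @child_root_arc n s.+1; rewrite subn1 /=; apply; lia.
    * lia.
    have [-> ->] : minn s.+1 s = lo d /\ maxn s.+1 s = (hi d).+1 by lia.
    apply: contains_sub cy => w w' [e cA]; split=> //.
    by rewrite arcsE d'0; apply: content_arcs_sub cA.
  + apply: use_dot; apply: (@child_dot_hi n d d') => //; last by lia.
      by rewrite -es.
    by rewrite dE; case: (d') d'0.
  have [td2 hd2] := td' d'0.
  (* The last dot was at the low end: one arc added to [d'] covers both that dot and the missing
     high one. *)
  exists (PArc (hi d' + 1) (lo d' - 1) :: d').
  have [e1 e2] : lo (PArc (hi d' + 1) (lo d' - 1) :: d') = lo d /\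
      hi (PArc (hi d' + 1) (lo d' - 1) :: d') = (hi d).+1.
    have := lo_le_hi d'; rewrite lo_cons // hi_consE /=; lia.
  rewrite e1 e2; split=> //.
  + by apply: in_tree_child td2 _; exact: child_arc.
  + lia.
  apply: contains_sub cy => w w' [e cA]; split=> //.
  by rewrite arcsE; apply: content_arcs_sub cA => a ad; rewrite inE ad orbT.
- exact: use_arc.
(* The low side is the mirror image. *)
have [yn|yn] := leqP (lo d).-1 1.
  apply: use_arc; apply: contains_sub cx => w w' [_ cA].
  apply: outrel_one_sided; first by left.
  by apply: content_arcs_sub cA => a ad; rewrite inE ad orbT.
have use_dot : child n d (PDot (lo d - 1) :: d) -> exists e, [/\ in_tree n e,
    e <> [::], hi d - lo d < hi e - lo e & contains P (lo e) (hi e) (arcs e)].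
  move=> ch; exists (PDot (lo d - 1) :: d); split=> //.
  + exact: in_tree_child td ch.
  + by rewrite lo_cons // hi_consE /=; lia.
  suff [-> ->] : lo (PDot (lo d - 1) :: d) = (lo d).-1 /\
    hi (PDot (lo d - 1) :: d) = hi d by [].
  by rewrite lo_cons // hi_consE /=; lia.
case: c dE => [s|y x] dE; last by apply: use_dot; apply: child_arc_lo dE _ _; lia.
have arcsE : arcs d = arcs d' by rewrite dE.
case: (dotE _ _ dE) => [[d'0 [el es]]|[d'0 es [el eh]]|[d'0 es [el eh]]].
+ exists [:: PArc s s.-1]; rewrite lo_arc1 hi_arc1; split=> //.
  * apply: in_tree_child (in_tree_root n) _.
    by have := @child_root_arc n s; rewrite subn1 /=; apply; lia.
  * lia.
  have [-> ->] : minn s s.-1 = (lo d).-1 /\ maxn s s.-1 = hi d by lia.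
  apply: contains_sub cx => w w' [e cA]; split=> //.
  by rewrite arcsE d'0; apply: content_arcs_sub cA.
+ have [td2 hd2] := td' d'0.
  exists (PArc (hi d' + 1) (lo d' - 1) :: d').
  have [e1 e2] : lo (PArc (hi d' + 1) (lo d' - 1) :: d') = (lo d).-1 /\
      hi (PArc (hi d' + 1) (lo d' - 1) :: d') = hi d.
    have := lo_le_hi d'; rewrite lo_cons // hi_consE /=; lia.
  rewrite e1 e2; split=> //.
  * by apply: in_tree_child td2 _; exact: child_arc.
  * lia.
  apply: contains_sub cx => w w' [e cA]; split=> //.
  by rewrite arcsE; apply: content_arcs_sub cA => a ad; rewrite inE ad orbT.
apply: use_dot; apply: (@child_dot_lo n d d') => //; last by lia.
  by rewrite -es.
by rewrite dE; case: (d') d'0.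
Qed.

Lemma contains_leaf d : in_tree n d -> d <> [::] ->
    contains P (lo d) (hi d) (arcs d) ->
  exists2 e, is_leaf n e & contains P (lo e) (hi e) (arcs e).
Proof.
have [m] := ubnP (n - (hi d - lo d)); elim: m d => // m IH d dm td d0 cd.
have [hd|hd] := boolP (has_end_arc n d); first by exists d.
have [e [te e0 de ce]] := contains_next td d0 hd cd.
apply: (IH e) => //.
by have [? ? _] := in_tree_bounds te e0; have := lo_le_hi e; lia.
Qed.

Lemma exists_leaf_contained : 1 < n ->
  exists2 e, is_leaf n e & contains P (lo e) (hi e) (arcs e).
Proof.
move=> n1; have [s /andP[s0 sn] cs] := contains_commuting hP n1.
have arc_leaf : contains P s s.+1 [:: (s, s.+1)] ->
    exists2 e, is_leaf n e & contains P (lo e) (hi e) (arcs e).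
  move=> h; apply: (@contains_leaf [:: PArc s.+1 s]) => //.
    apply: in_tree_child (in_tree_root n) _.
    by have := @child_root_arc n s.+1; rewrite subn1 /=; apply; lia.
  rewrite lo_arc1 hi_arc1.
  by have [-> ->] : minn s.+1 s = s /\ maxn s.+1 s = s.+1 by lia.
have dot_leaf k : 2 <= k <= n - 1 -> contains P k k [::] ->
    exists2 e, is_leaf n e & contains P (lo e) (hi e) (arcs e).
  move=> kn h; apply: (@contains_leaf [:: PDot k]) => //.
    by apply: in_tree_child (in_tree_root n) _; exact: child_root_dot.
  by rewrite lo_dot1 hi_dot1.
(* From the empty interval the three cases are the dot [s], the arc joining [s] and [s.+1], and the
   dot [s.+1]. Dots at 1 and [n] are not in the tree, and the arc replaces them. *)
have [cx|ca|cy] := contains_step hP (s0 : 1 < s.+1) sn (leqnn _) cs.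
- have [s1|s1] := leqP s 1; last by apply: (dot_leaf s) => //; lia.
  apply: arc_leaf; apply: contains_sub cx => w w' [_ cA].
  by apply: outrel_one_sided; [left | apply: content_arcs_sub cA].
- exact: arc_leaf ca.
have [s1|s1] := leqP n s.+1; last by apply: (dot_leaf s.+1) => //; lia.
apply: arc_leaf; apply: contains_sub cy => w w' [_ cA].
by apply: outrel_one_sided; [right | apply: content_arcs_sub cA].
Qed.

End Descent.

(** * Separating words *)

Local Open Scope nat_scope.

Definition nested (a b : nat * nat) := (a.1 < b.1) && (b.2 < a.2).

(** The centre [c] separates the ends of every arc, so a single word can put the q's before the p's
    for all arcs at once. *)
Lemma arcs_nested n d : in_tree n d -> d <> [::] ->
  [/\ forall a : nat * nat, a \in arcs d -> lo d <= a.1 /\ a.2 <= hi d,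
      exists c, lo d <= c <= hi d /\ forall a : nat * nat, a \in arcs d -> a.1 <= c < a.2
    & pairwise nested (arcs d)].
Proof.
elim=> // {}d e td IH de _; have lh := lo_le_hi d.
have [d0|d0] : d = [::] \/ d <> [::] by case: (d); [left | right].
  subst; inversion de as [s hs|s hs| | | | |] => //; subst.
    by rewrite lo_dot1 hi_dot1; split=> //; exists s; split=> //; lia.
  rewrite lo_arc1 hi_arc1; split=> //.
    by move=> a; rewrite inE => /eqP -> /=; lia.
  exists (s - 1); split; first by lia.
  by move=> a; rewrite inE => /eqP -> /=; lia.
have [i1 [c [hc i2]] i3] := IH d0; have [l1 l2 l3] := in_tree_bounds td d0.
have [k -> [/l3 {l3}[l3 l4] kE]] := child_cases de d0.
rewrite lo_cons // hi_consE.
case: kE => [->|[-> ?]|[-> ?]] /=; first last.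
- split; [by move=> a /i1; lia | | exact: i3].
  by exists c; split; [lia | exact: i2].
- split; [by move=> a /i1; lia | | exact: i3].
  by exists c; split; [lia | exact: i2].
rewrite /arcs /= -/(arcs d); split.
- by move=> a; rewrite inE => /predU1P[-> /=|/i1]; lia.
- exists c; split; first by lia.
  by move=> a; rewrite inE => /predU1P[-> /=|/i2]; lia.
by rewrite /= i3 andbT; apply/allP => a /i1; rewrite /nested /=; lia.
Qed.

Lemma bc_no_low x y w : {in w, forall l, x < l} ->
  bc x y w = (0, count (fun l => y <= l) w).
Proof.
elim: w => //= l w IH h; rewrite IH; last by move=> i iw; apply: h; rewrite inE iw orbT.
have := h l (mem_head _ _); rewrite /bmul /bval /= => xl.
by congr pair; lia.
Qed.

Lemma bc_no_high x y w : {in w, forall l, l < y} ->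
  bc x y w = (count (fun l => l <= x) w, 0).
Proof.
elim: w => //= l w IH h; rewrite IH; last by move=> i iw; apply: h; rewrite inE iw orbT.
have := h l (mem_head _ _); rewrite /bmul /bval /= => xl.
by congr pair; lia.
Qed.

(** The letters chosen for the outermost arc count for all inner arcs too, so the inner targets are
    shifted by them. Letters of inner arcs are invisible to the outermost one. *)
Lemma nested_words A (p q : nat * nat -> nat) : pairwise nested A ->
  exists xs ys, [/\ {subset xs <= map fst A}, {subset ys <= map snd A}
    & forall a : nat * nat, a \in A -> count (fun l => l <= a.1) xs + q a =
                           count (fun l => a.2 <= l) ys + p a].
Proof.
elim: A p q => [|a A IH] p q /=; first by exists [::], [::].
case/andP=> /allP aA /(IH (fun b => p b + q a) (fun b => q b + p a)).
move=> [xs [ys [hx hy e]]].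
exists (nseq (p a) a.1 ++ xs), (nseq (q a) a.2 ++ ys); split.
- move=> l; rewrite mem_cat mem_nseq inE => /orP[/andP[_ ->] //|/hx ->].
  by rewrite orbT.
- move=> l; rewrite mem_cat mem_nseq inE => /orP[/andP[_ ->] //|/hy ->].
  by rewrite orbT.
move=> b; rewrite !count_cat !count_nseq inE => /predU1P[->|bA].
  rewrite !leqnn !mul1n.
  have -> : count (fun l => l <= a.1) xs = 0.
    rewrite -(count_pred0 xs); apply: eq_in_count => l /hx /mapP[c cA ->] /=.
    by have /andP[h _] := aA _ cA; lia.
  have -> : count (fun l => a.2 <= l) ys = 0.
    rewrite -(count_pred0 ys); apply: eq_in_count => l /hy /mapP[c cA ->] /=.
    by have /andP[_ h] := aA _ cA; lia.
  lia.
have /andP[h1 h2] := aA _ bA; have := e b bA.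
have -> : a.1 <= b.1 by lia.
have -> : b.2 <= a.2 by lia.
lia.
Qed.

(** With the high letters first, each arc reads a power of q followed by a power of p, and only the
    truncated differences of the exponents survive. *)
Lemma bridge_word n d (p q : nat * nat -> nat) : in_tree n d -> d <> [::] ->
  exists2 w, valid_word n w & forall a : nat * nat, a \in arcs d ->
    bc a.1 a.2 w = (p a - q a, q a - p a).
Proof.
move=> td d0; have [i1 [c [hc i2]] i3] := arcs_nested td d0.
have [l1 l2 _] := in_tree_bounds td d0.
have [xs [ys [hx hy e]]] := nested_words p q i3.
have xc l : l \in xs -> 0 < l <= c.
  by move=> /hx /mapP[b /[dup] /i1 ? /i2 ? ->]; lia.
have yc l : l \in ys -> c < l <= n.
  by move=> /hy /mapP[b /[dup] /i1 ? /i2 ? ->]; lia.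
exists (ys ++ xs).
  rewrite /valid_word all_cat; apply/andP; split; apply/allP => l.
    by move=> /yc; lia.
  by move=> /xc; lia.
move=> a aA; have h := i2 _ aA; rewrite bc_cat bc_no_low; last first.
  by move=> l /yc; lia.
rewrite bc_no_high; last by move=> l /xc; lia.
by have {}e := e _ aA; rewrite /bmul /=; congr pair; lia.
Qed.

Lemma seq_extremum (T : eqType) (r : rel T) (S : seq T) : total r -> transitive r ->
  S <> [::] -> exists2 s, s \in S & forall t, t \in S -> r s t.
Proof.
move=> rt rtr; elim: S => // s S IH _; have rr x : r x x by have /orP[] := rt x x.
case: S IH => [|s' S] IH.
  by exists s; rewrite ?mem_head // => t; rewrite inE => /eqP ->.
have [//|m mS hm] := IH; have /orP[sm|ms] := rt s m.
  exists s; first exact: mem_head.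
  by move=> t; rewrite inE => /predU1P[->//|/hm]; apply: rtr.
exists m; first by rewrite inE mS orbT.
by move=> t; rewrite inE => /predU1P[->//|/hm].
Qed.

(** A lexicographic maximum: the coordinates in [L] are maximised one after another in both lists,
    and a sum of maxima is attained only by maxima. *)
Lemma unique_sum (T : eqType) (c : nat -> T -> nat) (L : seq nat) (S S' : seq T) :
  S <> [::] -> S' <> [::] ->
  exists s0 t0, [/\ s0 \in S, t0 \in S' & forall s t, s \in S -> t \in S' ->
    {in L, forall l, c l s + c l t = c l s0 + c l t0} ->
    {in L, forall l, c l s = c l s0 /\ c l t = c l t0}].
Proof.
elim: L S S' => [|l L IH] S S' S0 S'0.
  case: S S0 => // s S _; case: S' S'0 => // t S' _.
  by exists s, t; rewrite !mem_head; split.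
have tot : total (fun s t => c l t <= c l s) by move=> s t; exact: leq_total.
have tr : transitive (fun s t => c l t <= c l s) by move=> s t u h h'; exact: leq_trans h' h.
have [m mS hm] := seq_extremum tot tr S0; have [m' mS' hm'] := seq_extremum tot tr S'0.
have [||s0 [t0 [s0S t0S h]]] := IH (filter (fun s => c l s == c l m) S)
  (filter (fun s => c l s == c l m') S').
- by move=> e; have := mem_filter (fun s => c l s == c l m) m S; rewrite e eqxx mS.
- by move=> e; have := mem_filter (fun s => c l s == c l m') m' S'; rewrite e eqxx mS'.
move: s0S t0S; rewrite !mem_filter => /andP[/eqP e0 s0S] /andP[/eqP e0' t0S].
exists s0, t0; split=> // s t sS tS e.
have el := e l (mem_head _ _); have hs := hm _ sS; have ht := hm' _ tS.
have [es et] : c l s = c l m /\ c l t = c l m' by lia.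
move=> k; rewrite inE => /predU1P[->|kL]; first by rewrite e0 e0'.
by apply: h => //; rewrite ?mem_filter ?es ?et ?eqxx // => i iL; apply: e; rewrite inE iL orbT.
Qed.

Local Close Scope nat_scope.

(** * Congruence ideals *)

Local Open Scope ring_scope.

Section CongruenceIdeal.
Variables (K : fieldType) (M : monomType) (T : Type) (k : M -> T).
Hypothesis kM : forall s s' t t', k s = k s' -> k t = k t' ->
  k (monalg.mmul s t) = k (monalg.mmul s' t').

Let eta s t := k s = k t.
Local Notation I := (congruence_ideal K eta).

Lemma congruence_ideal_gen c s t : eta s t -> I (c *: (<< s >> - << t >>)).
Proof.
move=> st; exists [:: (c, (s, t))]; split; last by rewrite big_seq1.
by move=> z; rewrite inE => /eqP ->.
Qed.

Lemma congruence_idealD a b : I a -> I b -> I (a + b).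
Proof.
move=> [r [hr ->]] [r' [hr' ->]]; exists (r ++ r'); rewrite big_cat; split=> // z.
by rewrite mem_cat => /orP[/hr|/hr'].
Qed.

Lemma congruence_ideal0 : I 0.
Proof. by exists [::]; rewrite big_nil; split. Qed.

Lemma congruence_ideal_sum (J : Type) (r : seq J) (F : J -> {malg K[M]}) :
  (forall i, I (F i)) -> I (\sum_(i <- r) F i).
Proof.
move=> h; elim: r => [|i r IH]; rewrite ?big_nil ?big_cons.
  exact: congruence_ideal0.
exact: congruence_idealD.
Qed.

Lemma congruence_ideal_two_sided : two_sided_ideal I.
Proof.
split; [exact: congruence_ideal0 | exact: congruence_idealD | move=> a b].
move=> [r [hr ->]]; rewrite (monalgE a) !mulr_sumr; split.
  elim: r hr => [|z r IH] hr; first by rewrite big_nil; exact: congruence_ideal0.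
  rewrite big_cons; apply: congruence_idealD; last first.
    by apply: IH => i ir; apply: hr; rewrite inE ir orbT.
  rewrite mulr_suml; apply: congruence_ideal_sum => j.
  rewrite malg_scaleAr malgUZ -scalerAl mulrBr !malgU_mul scalerA.
  apply: congruence_ideal_gen; apply: kM => //.
  exact: (hr _ (mem_head _ _)).
apply: congruence_ideal_sum => j.
rewrite mulr_suml.
elim: r hr => [|z r IH] hr; first by rewrite big_nil; exact: congruence_ideal0.
rewrite big_cons; apply: congruence_idealD; last first.
  by apply: IH => i ir; apply: hr; rewrite inE ir orbT.
rewrite malgUZ malg_scaleAr -scalerAl mulrBl !malgU_mul scalerA.
apply: congruence_ideal_gen; apply: kM => //.
exact: (hr _ (mem_head _ _)).
Qed.

(** The choice is made from a set depending only on the class of [s]. The set contains [s], so the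
    default is never taken. *)
Definition class_rep (s : M) : M := xget monalg.mone [set t | k s = k t].

Lemma class_repP s : k (class_rep s) = k s.
Proof. by rewrite /class_rep; case: xgetP => [t _ <- //|/(_ s) []]. Qed.

Lemma class_rep_eq s t : k s = k t -> class_rep s = class_rep t.
Proof. by rewrite /class_rep => ->. Qed.

(** This is [f] modulo the ideal, arranged so that distinct monomials of the support lie in distinct
    classes. *)
Definition reduced (f : {malg K[M]}) := \sum_(s <- msupp f) << f@_s *g class_rep s >>.

Lemma reduced_mod f : I (f - reduced f).
Proof.
rewrite {1}(monalgE f) /reduced -sumrB; apply: congruence_ideal_sum => s.
rewrite (malgUZ f@_s s) (malgUZ f@_s (class_rep s)) -scalerBr; apply: congruence_ideal_gen.
by rewrite /eta class_repP.
Qed.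

Lemma reduced_supp f s t : s \in msupp (reduced f) -> t \in msupp (reduced f) ->
  k s = k t -> s = t.
Proof.
have rep u : u \in msupp (reduced f) -> class_rep u = u.
  rewrite -mcoeff_neq0 /reduced raddf_sum /= => h.
  have [v e] : exists v, class_rep v = u.
    apply: contrapT => nv; move: h; rewrite big1 ?eqxx // => v _.
    by rewrite mcoeffU; case: eqP => // e; case: nv; exists v.
  by rewrite -e; apply: class_rep_eq; rewrite class_repP.
by move=> /rep {2}<- /rep {2}<- /class_rep_eq.
Qed.

(** The linear functional adding up the coefficients on [Q]; it kills the congruence ideal when [Q]
    is constant on classes. *)
Definition weigh (Q : M -> bool) (f : {malg K[M]}) : K :=
  mmap idfun (fun s => (Q s)%:R) f.

Lemma weigh_congruence_ideal Q f :
  (forall s t, k s = k t -> Q s = Q t) -> I f -> weigh Q f = 0.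
Proof.
move=> hQ [r [hr ->]]; rewrite /weigh raddf_sum /= big_seq big1 // => z /hr ez.
by rewrite scalerBr -!malgUZ raddfB /= !mmapU (hQ _ _ ez) subrr.
Qed.

Lemma weigh_mul Q f g w s0 t0 : s0 \in msupp f -> t0 \in msupp g ->
    (forall s t, s \in msupp f -> t \in msupp g ->
      Q (monalg.mmul (monalg.mmul s w) t) = (s == s0) && (t == t0)) ->
  weigh Q (f * << w >> * g) = f@_s0 * g@_t0.
Proof.
move=> hs ht hQ.
have -> : f * << w >> * g = \sum_(s <- msupp f) \sum_(t <- msupp g)
    << f@_s * g@_t *g monalg.mmul (monalg.mmul s w) t >>.
  have fE : f * << w >> = \sum_(s <- msupp f) << f@_s *g s >> * << w >>.
    by rewrite -mulr_suml; congr (_ * _); exact: monalgE.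
  have gE X : X * g = \sum_(t <- msupp g) X * << g@_t *g t >>.
    by rewrite -mulr_sumr; congr (_ * _); exact: monalgE.
  rewrite fE mulr_suml; apply: eq_bigr => s _.
  rewrite gE; apply: eq_bigr => t _.
  by rewrite !malgM_def !fgmulUU mulr1.
have wE s t : weigh Q << f@_s * g@_t *g monalg.mmul (monalg.mmul s w) t >> =
    f@_s * g@_t * (Q (monalg.mmul (monalg.mmul s w) t))%:R by exact: mmapU.
have wsum (J : Type) (r : seq J) (F : J -> {malg K[M]}) :
    weigh Q (\sum_(i <- r) F i) = \sum_(i <- r) weigh Q (F i) by exact: raddf_sum.
rewrite wsum; under eq_bigr => s _ do
  [rewrite wsum; under eq_bigr => t _ do rewrite wE].
rewrite (bigD1_seq s0) ?fset_uniq //= (bigD1_seq t0) ?fset_uniq //=.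
rewrite hQ // !eqxx mulr1 !big1_seq ?addr0 // => s /andP[ns sf].
  by rewrite big1_seq // => t /andP[_ tg]; rewrite hQ // (negPf ns) mulr0.
by rewrite hQ // (negPf ns) andbF mulr0.
Qed.

End CongruenceIdeal.

Local Close Scope ring_scope.

(** * Primality at the leaves *)

Local Open Scope nat_scope.

Lemma end_arc_one_sided n d : has_end_arc n d -> lo d <= 1 \/ n <= hi d.
Proof.
elim: d => // c d IH; rewrite /has_end_arc /= => /orP[|].
  case: c => // y x; rewrite -/(piece_indices (PArc y x)).
  by case/orP=> /(lo_hi_cons d) /andP[? ?]; [left | right].
case: d IH => // e d IH /IH.
by have := hi_cons c (e :: d); have := lo_cons_le c e d; lia.
Qed.

Lemma bmul_bridge s t : bmul s (bmul (s.2 - t.1, t.1 - s.2) t) = (s.1, t.2).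
Proof. by case: s t => a b [c d]; rewrite /bmul /=; congr pair; lia. Qed.

Lemma leq_bmul s r t : s.1 <= (bmul s (bmul r t)).1.
Proof. exact: leq_addr. Qed.

(** The bridge is fitted to [m] unmatched p's on its right; any further p's of [t] would survive in
    the product. *)
Lemma bmul_bridge_leq s m t :
  (bmul s (bmul (s.2 - m, m - s.2) t)).1 <= s.1 -> t.1 <= m.
Proof. by case: s t => a b [c d]; rewrite /bmul /=; lia. Qed.

Lemma mul_perturb (R : nzRingType) (a a' w b b' : R) :
  (a' * w * b' = a * w * b - (a - a') * w * b - a' * w * (b - b'))%R.
Proof. by rewrite !mulrBl mulrBr opprB addrCA subrr addr0 opprB addrCA subrr addr0. Qed.

Lemma two_sided_perturb (K : fieldType) (M : monomType) (P : set {malg K[M]})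
    (a a' w b b' : {malg K[M]}) : two_sided_ideal P ->
  P (a * w * b)%R -> P (a - a')%R -> P (b - b')%R -> P (a' * w * b')%R.
Proof.
move=> iP ab aa bb.
rewrite (mul_perturb a a' w b b').
have h := two_sidedB iP ab (two_sidedMr iP b (two_sidedMr iP w aa)).
exact: (two_sidedB iP h (two_sidedMl iP (a' * w)%R bb)).
Qed.

Section LeafPrime.
Variables (K : fieldType) (n : nat) (d : diagram).
Hypothesis leaf : is_leaf n d.
Local Notation M := (chinese_monoid n).

Definition word_of (s : M) : seq nat := map val (repr s).

Lemma word_ofK s : mword n (word_of s) = s.
Proof. by rewrite mword_pi reprK. Qed.

Lemma word_of_valid s : valid_word n (word_of s).
Proof. by apply/allP => l /mapP[i _ ->]; case: i. Qed.

(** An end arc leaves letters on one side only, so the component in C_r records nothing beyond the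
    content. *)
Lemma kappa_leaf w w' : valid_word n w -> valid_word n w' ->
  kappa d (mword n w) = kappa d (mword n w') <-> content_arcs (arcs d) w w'.
Proof.
case: leaf => td; case: d td => // c d' td _ /end_arc_one_sided od.
move=> /valid_word_lift[x ->] /valid_word_lift[x' ->].
rewrite !mword_pi; split; first by move=> /(rho_outrel x x' td)[].
by move=> h; apply/(rho_outrel x x' td)/outrel_one_sided.
Qed.

Lemma kappa_leaf_word s t :
  kappa d s = kappa d t <-> content_arcs (arcs d) (word_of s) (word_of t).
Proof.
by rewrite -{1}(word_ofK s) -{1}(word_ofK t); apply: kappa_leaf; exact: word_of_valid.
Qed.

Lemma word_of_mul s t : content_arcs (arcs d) (word_of (s * t)%g) (word_of s ++ word_of t).
Proof.
apply/kappa_leaf; rewrite ?valid_word_cat ?word_of_valid //.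
by rewrite word_ofK /mword ev_cat -!/(mword n _) !word_ofK.
Qed.

Lemma kappa_leaf_mul (s s' t t' : M) : kappa d s = kappa d s' ->
  kappa d t = kappa d t' -> kappa d (monalg.mmul s t) = kappa d (monalg.mmul s' t').
Proof.
move=> /kappa_leaf_word h /kappa_leaf_word h'; apply/kappa_leaf_word.
apply: content_arcs_trans (word_of_mul s t) _.
apply: content_arcs_trans (content_arcs_sym (word_of_mul s' t')).
exact: content_arcs_cat.
Qed.

Let depth (s : M) := \sum_(a <- arcs d) (bc a.1 a.2 (word_of s)).1.

(** Turns minimality of the total into equality on every single arc. *)
Lemma depth_eq (s t : M) : depth t <= depth s ->
    (forall a : nat * nat, a \in arcs d ->
      (bc a.1 a.2 (word_of s)).1 <= (bc a.1 a.2 (word_of t)).1) ->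
  forall a : nat * nat, a \in arcs d ->
    (bc a.1 a.2 (word_of s)).1 = (bc a.1 a.2 (word_of t)).1.
Proof.
rewrite /depth; elim: (arcs d) => // b A IH; rewrite !big_cons => ts st.
have hb := st b (mem_head _ _).
have hA : forall a : nat * nat, a \in A ->
    (bc a.1 a.2 (word_of s)).1 <= (bc a.1 a.2 (word_of t)).1.
  by move=> a aA; apply: st; rewrite inE aA orbT.
have hS : \sum_(a <- A) (bc a.1 a.2 (word_of s)).1 <=
    \sum_(a <- A) (bc a.1 a.2 (word_of t)).1.
  by rewrite big_seq [X in _ <= X]big_seq; apply: leq_sum.
move=> a; rewrite inE => /predU1P[->|aA]; first by lia.
by apply: IH => //; lia.
Qed.

Definition below (z0 z : M) : bool :=
  all (fun l => count_mem l (word_of z) == count_mem l (word_of z0)) (iota 1 n) &&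
  all (fun a => (bc a.1 a.2 (word_of z)).1 <= (bc a.1 a.2 (word_of z0)).1) (arcs d).

Lemma below_kappa z0 s t : kappa d s = kappa d t -> below z0 s = below z0 t.
Proof.
move=> /kappa_leaf_word[e1 e2]; rewrite /below; congr (_ && _).
  by apply: eq_all => l; rewrite e1.
by apply: eq_in_all => a aA; rewrite e2.
Qed.

Lemma valid_count_eq w w' : valid_word n w -> valid_word n w' ->
  {in iota 1 n, forall l, count_mem l w = count_mem l w'} ->
  forall l, count_mem l w = count_mem l w'.
Proof.
move=> vw vw' e l; have [/e//|nl] := boolP (l \in iota 1 n).
have cl s : valid_word n s -> count_mem l s = 0.
  move=> /allP vs; apply/count_memPn; apply: contra nl => /vs.
  by rewrite mem_iota; lia.
by rewrite !cl.
Qed.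

(* The arc depths of s (w t) determine those of s and t below the chosen pair
   because w cancels the unmatched letters of s0 against those of t0. *)
Lemma separating_triple (S S' : seq M) : S <> [::] -> S' <> [::] ->
    (forall s t, s \in S -> t \in S -> kappa d s = kappa d t -> s = t) ->
    (forall s t, s \in S' -> t \in S' -> kappa d s = kappa d t -> s = t) ->
  exists s0 t0 w, [/\ s0 \in S, t0 \in S' & forall s t, s \in S -> t \in S' ->
    below (s0 * w * t0)%g (s * w * t)%g = (s == s0) && (t == t0)].
Proof.
move=> S0 S'0 Sinj S'inj; have [td d0 _] := leaf.
pose c l (s : M) := count_mem l (word_of s).
(* First the contents are fixed: no pair with other contents attains the same sum. *)
have [s1 [t1 [s1S t1S cu]]] := unique_sum c (iota 1 n) S0 S'0.
pose same s1 (s : M) := all (fun l => c l s == c l s1) (iota 1 n).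
have tot : total (fun s t => depth s <= depth t) by move=> s t; exact: leq_total.
have tr : transitive (fun s t => depth s <= depth t) by move=> s t u; exact: leq_trans.
have minim (R : seq M) r : r \in R -> exists2 r0, r0 \in filter (same r) R &
    forall t, t \in filter (same r) R -> depth r0 <= depth t.
  move=> rR; apply: seq_extremum => // e.
  have := mem_filter (same r) r R; rewrite e rR andbT => /esym/negP[].
  by apply/allP => l _.
(* Then the total of unmatched p's is minimised among the elements with these contents. *)
have [s0 + s0m] := minim _ _ s1S; have [t0 + t0m] := minim _ _ t1S.
rewrite !mem_filter => /andP[t01 t0S] /andP[s01 s0S].
have sameP r s : same r s -> forall l, c l s = c l r.
  move=> /allP h; apply: valid_count_eq; rewrite ?word_of_valid // => l /h /eqP.
  by [].
pose p (a : nat * nat) := (bc a.1 a.2 (word_of s0)).2.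
pose q (a : nat * nat) := (bc a.1 a.2 (word_of t0)).1.
have [w vw bw] := bridge_word p q td d0.
exists s0, t0, (mword n w); split=> // s t sS tS.
have prodE x y : content_arcs (arcs d) (word_of (x * mword n w * y)%g)
    (word_of x ++ w ++ word_of y).
  rewrite catA; apply: content_arcs_trans (word_of_mul _ _) _.
  apply: content_arcs_cat; last exact: content_arcs_refl.
  apply: content_arcs_trans (word_of_mul _ _) _.
  apply: content_arcs_cat; first exact: content_arcs_refl.
  by apply/kappa_leaf; rewrite ?word_of_valid ?word_ofK.
apply/idP/andP => [|[/eqP-> /eqP->]]; last first.
  by apply/andP; split; apply/allP.
case/andP=> /allP eC /allP eA.
have ec : {in iota 1 n, forall l, c l s + c l t = c l s1 + c l t1}.
  move=> l /eC /eqP; rewrite !(prodE _ _).1 !count_cat -!/(c l _).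
  rewrite (sameP _ _ s01 l) (sameP _ _ t01 l) addnCA [RHS]addnCA.
  exact: addnI.
have {ec} cst := cu _ _ sS tS ec.
have ss1 : same s1 s by apply/allP => l /cst[-> _].
have tt1 : same t1 t by apply/allP => l /cst[_ ->].
have cs l : c l s = c l s0 by rewrite (sameP _ _ ss1) (sameP _ _ s01).
have ct l : c l t = c l t0 by rewrite (sameP _ _ tt1) (sameP _ _ t01).
(* By [bmul_bridge], the product of [s0], [w] and [t0] has exactly the unmatched p's of [s0]. *)
have bound (a : nat * nat) : a \in arcs d ->
    (bmul (bc a.1 a.2 (word_of s)) (bmul (p a - q a, q a - p a)
      (bc a.1 a.2 (word_of t)))).1 <= (bc a.1 a.2 (word_of s0)).1.
  move=> aA; have := eA a aA; rewrite (prodE s t).2 // (prodE s0 t0).2 //.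
  by rewrite !bc_cat bw // bmul_bridge.
(* Unmatched p's of a left factor survive in the product, so minimality identifies [s] with [s0].
   Only then is [w] fitted to [s], and [t] can be bounded. *)
have ds a : a \in arcs d -> (bc a.1 a.2 (word_of s)).1 = (bc a.1 a.2 (word_of s0)).1.
  apply: depth_eq; first by apply: s0m; rewrite mem_filter ss1.
  by move=> b /bound; apply: leq_trans; apply: leq_bmul.
have s_s0 : s = s0.
  by apply: Sinj => //; apply/kappa_leaf_word; split.
split; apply/eqP => //.
apply: S'inj => //; apply/kappa_leaf_word; split => //.
apply: depth_eq; first by apply: t0m; rewrite mem_filter tt1.
by move=> a /bound; rewrite s_s0; apply: bmul_bridge_leq.
Qed.

Lemma leaf_prime : prime_two_sided_ideal (congruence_ideal K (rho n d)).
Proof.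
have iP : two_sided_ideal (congruence_ideal K (rho n d)).
  exact: (@congruence_ideal_two_sided K _ _ _ kappa_leaf_mul).
split=> // [e|I J iI iJ IJ].
  have h1 : congruence_ideal K (rho n d) 1%R by rewrite e.
  (* With [Q] always true this is the augmentation, which does not kill 1. *)
  have := weigh_congruence_ideal (Q := xpredT) (fun _ _ _ => erefl) h1.
  by rewrite -mpolyC1E /weigh mmapU /= mulr1 => /eqP; rewrite oner_eq0.
apply: contrapT => /not_orP[nI nJ].
have [f If nf] : exists2 f, I f & ~ congruence_ideal K (rho n d) f.
  by apply: contrapT => h; apply: nI => f If; apply: contrapT => nf; apply: h; exists f.
have [g Jg ng] : exists2 g, J g & ~ congruence_ideal K (rho n d) g.
  by apply: contrapT => h; apply: nJ => g Jg; apply: contrapT => ng; apply: h; exists g.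
pose rf := reduced (@kappa n d) f; pose rg := reduced (@kappa n d) g.
have mf : congruence_ideal K (rho n d) (f - rf)%R := reduced_mod _ f.
have mg : congruence_ideal K (rho n d) (g - rg)%R := reduced_mod _ g.
have nz h rh : congruence_ideal K (rho n d) (h - rh)%R ->
    ~ congruence_ideal K (rho n d) h -> (msupp rh : seq M) <> [::].
  move=> m nh e; apply: nh; have r0 : rh = 0%R.
    apply/malgP => k; rewrite mcoeff0; apply: mcoeff_outdom.
    by rewrite -[_ \in _]/(k \in (msupp rh : seq M)) e.
  by move: m; rewrite r0 subr0.
have [s0 [t0 [w [s0f t0g sep]]]] := separating_triple (nz _ _ mf nf) (nz _ _ mg ng)
  (@reduced_supp _ _ _ _ f) (@reduced_supp _ _ _ _ g).
have fg : congruence_ideal K (rho n d) (f * << w >> * g)%R.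
  by case: iI => _ _ /(_ << w >>%R f If)[_ fw]; apply: (IJ _ _ fw Jg).
have rfg := two_sided_perturb iP fg mf mg.
(* The functional vanishes on the product, yet by [weigh_mul] its value is a product of two nonzero
   coefficients. *)
have w0 := weigh_congruence_ideal (k := @kappa n d)
  (below_kappa (s0 * w * t0)%g) rfg.
have := weigh_mul s0f t0g sep; rewrite w0.
move=> /esym/eqP; rewrite mulf_eq0 => /orP[] /eqP h.
  by move: s0f; rewrite -[_ \in _]/(s0 \in msupp rf) -mcoeff_neq0 h eqxx.
by move: t0g; rewrite -[_ \in _]/(t0 \in msupp rg) -mcoeff_neq0 h eqxx.
Qed.

End LeafPrime.

Local Close Scope nat_scope.
Local Close Scope group_scope.
Local Close Scope quotient_scope.

Theorem theorem2p3p1 (K : fieldType) (n : nat) (hn : (3 <= n)%N)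
    (P : set {malg K[chinese_monoid n]}) (hP : prime_two_sided_ideal P) :
  exists d : diagram,
    [/\ is_leaf n d,
        prime_two_sided_ideal (congruence_ideal K (rho n d))
      & congruence_ideal K (rho n d) `<=` P].
Proof.
have [d leaf cP] := exists_leaf_contained hP (ltnW hn).
exists d; split=> //; first exact: leaf_prime.
have iP : two_sided_ideal P by case: hP.
case: leaf cP => td; case: d td => // c d td _ _ cP.
exact: contains_congruence_ideal.
Qed.
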